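(* Let $\Delta t>0$ and let $(x_i)_{i=1}^n$ be an equally $\Delta t$-time spaced trajectory of a dynamical system generated by $L$ at a stationary distribution $\pi$. Assume that the RKHS $\mathcal{H}$ is generated by the kernel $k(x,x')$, let $K=[k(x_i,x_j)]_{i,j=1}^n\in\mathbb{R}^{n\times n}$ be the kernel Gram matrix, and let $\overline K=\frac1nJ_nKJ_n$ and $\overline K_\gamma=\overline K+\gamma I\in\mathbb{R}^{n\times n}$, $\gamma>0$, be its centered and regularized versions. Let $U_r=[u_1\,|\,\cdots\,|\,u_r]$ be the matrix with $n$ rows and $r$ columns consisting of eigenvectors corresponding to the $r$ largest eigenvalues $\sigma_i^2$ of the generalized eigenvalue problem $$T_n\overline K\,T_n^H\overline K\,u_i=\sigma_i^2\,\overline K_\gamma u_i,\qquad u_i^H\overline K\,\overline K_\gamma u_i=1,\qquad i=1,\dots,r,$$ and let $V_r=\overline KU_r$. Assume that the $r\times r$ matrix $V_r^H T_nV_r$ is non-defective, and let $(\widehat\nu_i,w_i^\ell,w_i^r)_{i=1}^r$ be its eigenvalue decomposition (eigenvalues, left eigenvectors, right eigenvectors). Then the spectral decomposition $(\widehat\nu_i,\widehat g_i,\widehat h_i)_{i=1}^r$ (eigenvalues, left eigenfunctions, right eigenfunctions, up to scaling of the eigenfunctions) of the reduced rank regression estimator $$\widehat G=(\widehat C_0+\gamma I)^{-1/2}\big[\!\big[(\widehat C_0+\gamma I)^{-1/2}\widehat W_a\big]\!\big]_r$$ is given by these $\widehat\nu_i$ together with $$\widehat g_i=\widehat S^*J_nT_n^HV_rw_i^\ell,\qquad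 \widehat h_i=\widehat S^*J_nU_rw_i^r,\qquad i=1,\dots,r.$$ Moreover, if $F(L)$ is self-adjoint, then the eigenvalues $\widehat\nu_i$ are real, while if $F(L)$ is skew-adjoint, then they are purely imaginary.
   Context: Setting. $L$ is the generator on $\mathcal{L}^2_\pi(\mathcal{X})$ of the transfer operator semigroup $A_t=e^{tL}$, $(A_tf)(x)=\mathbb{E}[f(X_t)\mid X_0=x]$, of a time-homogeneous Markov process $(X_t)$ on $\mathcal{X}\subset\mathbb{R}^d$ with invariant distribution $\pi$ (deterministic flows included). $(a_j)_{j\in\mathbb{Z}}\subset\mathbb{C}$ are the coefficients of a Toeplitz symbol $T(z)=\sum_{j\in\mathbb{Z}}a_jz^j$ on the unit circle, extended to the closed unit disk by $T(z)=a_0+\sum_{j\ge1}(a_jz^j+a_{-j}\bar z^j)$. $F(L):=T(A_{\Delta t})$ is obtained by putting $A_{\Delta t}^j$ in place of $z^j$ and $(A_{\Delta t}^* )^j$ in place of $\bar z^j$, and $F$ is assumed bounded on the spectrum of $L$. RKHS. $\mathcal{H}\subset\mathcal{L}^2_\pi(\mathcal{X})$ is a (possibly infinite-dimensional) reproducing kernel Hilbert space with real kernel $k$ and feature map $\phi\colon\mathcal{X}\to\mathcal{H}$, $k(x,x')=\langle\phi(x),\phi(x')\rangle_{\mathcal{H}}$. The sampling operator $\widehat S\colon\mathcal{H}\to\mathbb{R}^n$ is $\widehat Sh=\frac{1}{\sqrt n}(h(x_i))_{i=1}^n$, with adjoint $\widehat S^*v=\frac{1}{\sqrt n}\sum_{i=1}^nv_i\phi(x_i)$.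 All spaces and operators are complexified where needed. Empirical operators. Let $\ell<n-2$ be the truncation level; only $a_j$ with $|j|\le\ell$ are used in the estimator. With $\bar\phi=\frac1n\sum_{i=1}^n\phi(x_i)$, $$\widehat C_j=\frac{1}{n-j}\sum_{i=1}^{n-j}[\phi(x_i)-\bar\phi]\otimes[\phi(x_{i+j})-\bar\phi],\qquad \widehat W_a=a_0\widehat C_0+\sum_{j=1}^{\ell}[a_j\widehat C_j+a_{-j}\widehat C_j^*],$$ where $(u\otimes v)h=\langle v,h\rangle u$. Matrices. $J_n=I-\frac1n ee^\top\in\mathbb{R}^{n\times n}$ with $e=(1,\dots,1)^\top$. $T_n$ is the $n\times n$ banded Toeplitz matrix with entries $(T_n)_{i,i+j}=\frac{n a_j}{n-|j|}$ for $-\ell\le j\le\ell$ (whenever both indices lie in $\{1,\dots,n\}$) and $0$ otherwise; it may be complex and need not be Hermitian. The superscript $H$ denotes the conjugate transpose. When the $a_j$ are real, $T_n$ is real, $U_r$ and $V_r$ can be taken real, and $H$ is the ordinary transpose $\top$ on all of these. Conventions. $1\le r\le n$. $[\![\cdot]\!]_r$ is the $r$-truncated singular value decomposition. In case of repeated eigenvalues the $u_i$ are chosen so that $U_r^H\overline K\,\overline K_\gamma U_r=I$, and the truncated SVD uses the corresponding singular vectors. Eigenvectors of $V_r^H T_nV_r$ satisfy $V_r^H T_nV_rw_i^r=\widehat\nu_iw_i^r$ and $(w_i^\ell)^HV_r^H T_nV_r=\widehat\nu_i(w_i^\ell)^H$, with $(w_i^\ell)^Hw_k^r=\delta_{ik}$.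 That $(\widehat\nu_i,\widehat g_i,\widehat h_i)_{i=1}^r$ is the spectral decomposition of $\widehat G$ (rank at most $r$) means: $\widehat G\widehat h_i=\widehat\nu_i\widehat h_i$ and $\widehat G^*\widehat g_i=\overline{\widehat\nu_i}\,\widehat g_i$ for all $i$, and the nonzero eigenvalues of $\widehat G$, counted with multiplicity, are exactly the nonzero $\widehat\nu_i$.
   Formalization: The last sentence fails as stated (A_Δt self-adjoint, T(z)=z: F(L) self-adjoint but T_n not Hermitian). Added for it: the symbol and its adjoint symbol (coefficients conj(a_{-j}), negated in the skew case) give the same F(L) only if they agree for |j| ≤ ℓ. *)

(* Defs.v *)
From HB Require Import structures.
From mathcomp Require Import all_boot all_order all_algebra complex.
From mathcomp Require Import all_classical all_reals all_analysis.

Set Implicit Arguments.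
Unset Strict Implicit.
Unset Printing Implicit Defensive.
Import Order.TTheory GRing.Theory Num.Theory.
Import numFieldNormedType.Exports numFieldTopology.Exports.

Local Open Scope classical_set_scope.
Local Open Scope ring_scope.
Local Open Scope complex_scope.

Notation "x ^_*" := (@Num.conj _ x) (at level 2, format "x ^_*").
Notation "M ^H" := (map_mx (@Num.conj _) (M^T)) (at level 8, format "M ^H").
(* [Complexify M] is the real matrix M with entries seen in R[i]. *)
Notation Complexify := (map_mx (real_complex _)).

(* Elements of complex L^2 are functions T -> R[i], not classes: equality in  *)
(* L^2 is expressed as a zero distance, [l2_dist2 mu f g = 0].                *)

Section ComplexL2.
Context (R : realType) (d : measure_display) (T : measurableType d).
Implicit Types (mu : {measure set T -> \bar R}) (f g : T -> R[i]).

Definition cintegral mu f : R[i] :=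
  (\int[mu]_x complex.Re (f x)) +i* (\int[mu]_x complex.Im (f x)).

Definition in_L2 mu f : Prop :=
  (fun x => complex.Re (f x)) \in Lfun mu 2%:E /\
  (fun x => complex.Im (f x)) \in Lfun mu 2%:E.

Definition l2_ip mu f g : R[i] := cintegral mu (fun x => f x * (g x)^_*).

Definition l2_dist2 mu f g : R :=
  complex.Re (l2_ip mu (fun x => f x - g x) (fun x => f x - g x)).

Definition l2_adjoint mu (A B : (T -> R[i]) -> T -> R[i]) : Prop :=
  [/\ forall f, in_L2 mu f -> in_L2 mu (A f),
      forall f, in_L2 mu f -> in_L2 mu (B f) &
      forall f g, in_L2 mu f -> in_L2 mu g ->
        l2_ip mu (A f) g = l2_ip mu f (B g)].

Definition l2_selfadjoint mu (A : (T -> R[i]) -> T -> R[i]) : Prop :=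
  l2_adjoint mu A A.

Definition l2_skewadjoint mu (A : (T -> R[i]) -> T -> R[i]) : Prop :=
  l2_adjoint mu A (fun f x => - A f x).

End ComplexL2.

Definition complex_cvg (R : realType) (u : nat -> R[i]) (l : R[i]) : Prop :=
  ((fun N => complex.Re (u N)) @ \oo --> complex.Re l) /\
  ((fun N => complex.Im (u N)) @ \oo --> complex.Im l).

Definition cexp (R : realType) (z : R[i]) : R[i] :=
  (expR (complex.Re z) * cos (complex.Im z)) +i*
  (expR (complex.Re z) * sin (complex.Im z)).

(* T, with its sigma-algebra, is (a copy of) a subset of R^D. *)
Definition subset_of_Rn (R : realType) (D : nat) (d : measure_display)
    (T : measurableType d) (emb : T -> D.-tuple (measurableTypeR R)) : Prop :=
  injective emb /\
  forall E : set T,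
    measurable E <-> exists2 B, measurable B & E = emb @^-1` B.

(* E[f(X_t) | X_0 = x] is the integral of f against the transition kernel     *)
(* p t x. Only times t >= 0 are meaningful.                                   *)

Section Markov.
Context (R : realType) (dO d : measure_display).
Context (Omega : measurableType dO) (T : measurableType d).
Implicit Types (P : probability Omega R) (X : R -> Omega -> T).
Implicit Types (pi : probability T R) (p : R -> R.-pker T ~> T).

(* The events of the process up to time s. *)
Definition past X (s : R) : set (set Omega) :=
  <<s [set E | exists u, exists B,
         [/\ 0 <= u <= s, measurable B & E = X u @^-1` B]] >>.

Definition transfer p (t : R) (f : T -> R[i]) (x : T) : R[i] :=
  cintegral (p t x) f.

Record stationary_markov P X pi p : Prop := StationaryMarkov {
  process_measurable : forall t, 0 <= t -> measurable_fun setT (X t);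
  kernel0 : forall x B, measurable B -> p 0 x B = \d_x B;
  kernelD : forall s t x B, 0 <= s -> 0 <= t -> measurable B ->
    p (s + t) x B = (\int[p s x]_y p t y B)%E;
  markov_property : forall s t E B, 0 <= s -> 0 <= t ->
    past X s E -> measurable B ->
    P (E `&` X (s + t) @^-1` B) = (\int[P]_(w in E) p t (X s w) B)%E;
  invariant : forall t B, 0 <= t -> measurable B ->
    (\int[pi]_x p t x B)%E = pi B;
  initial_law : forall B, measurable B -> P (X 0 @^-1` B) = pi B;
  transfer_L2 : forall t f, 0 <= t -> in_L2 pi f -> in_L2 pi (transfer p t f);
  transfer_continuous : forall f, in_L2 pi f ->
    (fun t => l2_dist2 pi (transfer p t f) f) @ 0^'+ --> (0 : R)
}.

(* Graph of the generator: f is in the domain of L and L f = g. *)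
Definition generator pi p (f g : T -> R[i]) : Prop :=
  [/\ in_L2 pi f, in_L2 pi g &
      (fun t : R => l2_dist2 pi
         (fun x => (t^-1)%:C * (transfer p t f x - f x)) g) @ 0^'+
      --> (0 : R)].

Definition in_resolvent_set pi p (z : R[i]) : Prop :=
  exists Rz : (T -> R[i]) -> T -> R[i], exists M : R,
  [/\ forall f, in_L2 pi f -> in_L2 pi (Rz f),
      forall f, in_L2 pi f ->
        l2_dist2 pi (Rz f) (fun=> 0) <= M * l2_dist2 pi f (fun=> 0),
      forall f, in_L2 pi f -> generator pi p (Rz f) (fun x => z * Rz f x - f x)
    & forall f g, generator pi p f g ->
        l2_dist2 pi (Rz (fun x => z * f x - g x)) f = 0].

Definition in_spectrum pi p (z : R[i]) : Prop := ~ in_resolvent_set pi p z.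

End Markov.

Section Symbol.
Context (R : realType).
Implicit Types (a b : int -> R[i]).

(* T(z) = a_0 + sum_(j >= 1) (a_j z^j + a_(-j) conj(z)^j) converges to w. *)
Definition symbol_value a (z w : R[i]) : Prop :=
  complex_cvg (fun N => a 0 + \sum_(1 <= j < N.+1)
    (a j%:Z * z ^+ j + a (- j%:Z) * z^_* ^+ j)) w.

(* F(z) = T(exp(z Dt)) is defined and bounded on the spectrum of L. *)
Definition bounded_on_spectrum (d : measure_display) (T : measurableType d)
    (pi : probability T R) (p : R -> R.-pker T ~> T) (Dt : R) a : Prop :=
  exists M : R, forall z, in_spectrum pi p z ->
    exists2 w, symbol_value a (cexp (z * Dt%:C)) w & `|w| <= M%:C.

(* F is T(A): A^j is put in place of z^j and As^j (As the adjoint of A) in    *)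
(* place of conj(z)^j; the series converges in the weak operator topology,    *)
(* the weakest usual requirement.                                             *)
Definition toeplitz_operator (d : measure_display) (T : measurableType d)
    (pi : probability T R) (A As : (T -> R[i]) -> T -> R[i]) a
    (F : (T -> R[i]) -> T -> R[i]) : Prop :=
  (forall f, in_L2 pi f -> in_L2 pi (F f)) /\
  forall f g, in_L2 pi f -> in_L2 pi g ->
    complex_cvg (fun N => a 0 * l2_ip pi f g + \sum_(1 <= j < N.+1)
      (a j%:Z * l2_ip pi (iter j A f) g + a (- j%:Z) * l2_ip pi (iter j As f) g))
      (l2_ip pi (F f) g).

(* The symbol of the adjoint operator: coefficient of index j is the          *)
(* conjugate of the coefficient of index -j.                                  *)
Definition adjoint_symbol a : int -> R[i] := fun j => (a (- j))^_*.

(* a and b give the same operator only if they have the same coefficients up  *)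
(* to order l. With b = adjoint_symbol a this excludes that T(A) is           *)
(* self-adjoint only by coincidence: if A itself is self-adjoint, so is T(A)  *)
(* for T(z) = z, although the Toeplitz matrix of T is not Hermitian. The      *)
(* property holds when A^j, As^j are independent, and also for every a that   *)
(* is equal to its adjoint symbol.                                            *)
Definition symbols_separated (d : measure_display) (T : measurableType d)
    (pi : probability T R) (A As : (T -> R[i]) -> T -> R[i]) (l : nat) a b
    : Prop :=
  forall F, toeplitz_operator pi A As a F -> toeplitz_operator pi A As b F ->
    forall j : int, (`|j| <= l)%N -> a j = b j.

End Symbol.

(* As for every [dot] form, [ip] is linear in its first argument.             *)

Section Operators.
Context (R : realType) (H : lmodType R[i]) (ip : {dot H for @Num.conj R[i]}).
Implicit Types (A B Q G : H -> H).

Definition complete_ip : Prop :=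
  forall u : nat -> H,
    (forall e : R, 0 < e -> exists N : nat, forall m n : nat,
       (N <= m)%N -> (N <= n)%N -> ip (u m - u n) (u m - u n) < e%:C) ->
    exists h, forall e : R, 0 < e -> exists N : nat, forall n : nat,
      (N <= n)%N -> ip (u n - h) (u n - h) < e%:C.

(* u (x) v : h |-> <v, h> u, where <v, h> must be linear in h. *)
Definition tens (u v h : H) : H := ip h v *: u.

Definition adjoint A : H -> H :=
  xget (fun=> 0) [set B | forall f g, ip (A f) g = ip f (B g)].

(* A^(-1/2): the positive self-adjoint Q such that Q^2 is the inverse of A. *)
Definition inv_sqrt A : H -> H :=
  xget (fun=> 0) [set Q | [/\ linear Q,
    forall f g, ip (Q f) g = ip f (Q g),
    forall h, 0 <= ip (Q h) h,
    forall h, Q (Q (A h)) = h & forall h, A (Q (Q h)) = h]].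

(* B = sum_(i < m) s_i p_i (x) q_i, with s_0 >= s_1 >= ... > 0 and p, q       *)
(* orthonormal; so m is the rank of B.                                        *)
Record svd B (m : nat) (s : 'I_m -> R) (p q : 'I_m -> H) : Prop := SVD {
  svd_gt0 : forall i, 0 < s i;
  svd_sorted : forall i j : 'I_m, (i <= j)%N -> s j <= s i;
  svd_left : forall i j, ip (p i) (p j) = (i == j)%:R;
  svd_right : forall i j, ip (q i) (q j) = (i == j)%:R;
  svd_sum : forall h, B h = \sum_i (s i)%:C *: tens (p i) (q i) h
}.

Definition svd_trunc (r m : nat) (s : 'I_m -> R) (p q : 'I_m -> H) (h : H) : H :=
  \sum_(i < m | (i < r)%N) (s i)%:C *: tens (p i) (q i) h.

(* The r-th and the (r+1)-st singular values coincide, so that the            *)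
(* r-truncated SVD depends on the choice of singular vectors.                 *)
Definition svd_tie (r m : nat) (s : 'I_m -> R) : Prop :=
  exists i j : 'I_m, [/\ i.+1 = r, j = r :> nat & s i = s j].

Definition alg_multiplicity G (z : R[i]) (m : nat) : Prop :=
  exists b : 'I_m -> H,
    (forall c : 'I_m -> R[i], \sum_i c i *: b i = 0 -> forall i, c i = 0) /\
    (forall h, (exists k, iter k (fun f => G f - z *: f) h = 0) <->
               (exists c : 'I_m -> R[i], h = \sum_i c i *: b i)).

(* (nu, g, h) = eigenvalues, left and right eigenfunctions. *)
Definition spectral_decomposition G (r : nat) (nu : 'I_r -> R[i])
    (g h : 'I_r -> H) : Prop :=
  [/\ forall i, G (h i) = nu i *: h i,
      forall i, adjoint G (g i) = (nu i)^_* *: g i &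
      forall z, z != 0 -> alg_multiplicity G z #|[set i | nu i == z]|].

End Operators.

(* H is the complexification of the RKHS of the real kernel k: the complex    *)
(* Hilbert space of functions [ev h : T -> R[i]] with reproducing kernel k.   *)

Record is_rkhs (R : realType) (d : measure_display) (T : measurableType d)
    (pi : probability T R) (H : lmodType R[i])
    (ip : {dot H for @Num.conj R[i]}) (ev : H -> T -> R[i])
    (phi : T -> H) (k : T -> T -> R) : Prop := IsRKHS {
  rkhs_complete : complete_ip ip;
  rkhs_functions : injective ev;
  rkhs_reproducing : forall h x, ev h x = ip h (phi x);
  rkhs_kernel : forall x y, (k x y)%:C = ip (phi x) (phi y);
  rkhs_L2 : forall h, in_L2 pi (ev h)
}.

Section Empirical.
Context (R : realType) (H : lmodType R[i]) (ip : {dot H for @Num.conj R[i]}).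
Context (T : Type) (phi : T -> H) (n : nat) (x : 'I_n -> T).
Local Notation C := R[i].

Definition sampling (ev : H -> T -> C) (h : H) : 'cV[C]_n :=
  \col_i (((Num.sqrt n%:R)^-1)%:C * ev h (x i)).

Definition sampling_adj (v : 'cV[C]_n) : H :=
  ((Num.sqrt n%:R)^-1)%:C *: \sum_i v i 0 *: phi (x i).

Definition feature_mean : H := n%:R^-1 *: \sum_i phi (x i).

Definition cov (j : nat) (h : H) : H :=
  (n - j)%:R^-1 *: \sum_(i < n) \sum_(i' < n | (i' == i + j :> nat)%N)
    tens ip (phi (x i) - feature_mean) (phi (x i') - feature_mean) h.

Definition reg_cov (gamma : R) (h : H) : H := cov 0 h + gamma%:C *: h.

Definition emp_W (a : int -> C) (l : nat) (h : H) : H :=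
  a 0 *: cov 0 h + \sum_(1 <= j < l.+1)
    (a j%:Z *: cov j h + a (- j%:Z) *: adjoint ip (cov j) h).

Definition centering : 'M[R]_n := 1%:M - const_mx n%:R^-1.

Definition gram (k : T -> T -> R) : 'M[R]_n := \matrix_(i, j) k (x i) (x j).

Definition cgram (k : T -> T -> R) : 'M[R]_n :=
  n%:R^-1 *: (centering *m gram k *m centering).

Definition reg_cgram (k : T -> T -> R) (gamma : R) : 'M[R]_n :=
  cgram k + gamma%:M.

(* (C_0 + gamma I)^(-1/2) W_a, whose truncated SVD enters the estimator. *)
Definition whitened_W (a : int -> C) (l : nat) (gamma : R) (h : H) : H :=
  inv_sqrt ip (reg_cov gamma) (emp_W a l h).

Definition rrr_estimator (gamma : R) (r m : nat) (s : 'I_m -> R)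
    (p q : 'I_m -> H) (h : H) : H :=
  inv_sqrt ip (reg_cov gamma) (svd_trunc ip r s p q h).

(* The left singular vector attached to the coefficient vector u is           *)
(* (C_0 + gamma I)^(1/2) S^* J_n u; the leading left singular vectors p are   *)
(* those attached to the columns of U.                                        *)
Definition corresponding_vectors (gamma : R) (r m : nat) (U : 'M[C]_(n, r))
    (p : 'I_m -> H) : Prop :=
  forall (i : 'I_m) (j : 'I_r), i = j :> nat ->
    inv_sqrt ip (reg_cov gamma) (p i) =
      sampling_adj (Complexify centering *m col j U).

Lemma sampling_adjE (ev : H -> T -> C) :
  (forall h t, ev h t = ip h (phi t)) ->
  forall h v, ip h (sampling_adj v) =
    \sum_i sampling ev h i 0 * (v i 0)^_*.
Proof.
move=> evE h v; rewrite /sampling_adj linearZr_LR linear_sumr /= mulr_sumr.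
apply: eq_bigr => i _; rewrite linearZr_LR mxE /= evE.
have -> : (((Num.sqrt n%:R)^-1)%:C : C)^_* = ((Num.sqrt n%:R)^-1)%:C.
  exact: conjc_real.
rewrite -mulrA; congr (_ * _); exact: mulrC.
Qed.

End Empirical.

Definition toeplitz_mx (R : realType) (n l : nat) (a : int -> R[i]) : 'M[R[i]]_n :=
  \matrix_(i, k) let j := (k%:Z - i%:Z)%R in
    if (`|j| <= l)%N then n%:R * a j / (n - `|j|)%:R else 0.

(* lam lists, in nonincreasing order and with multiplicity, the eigenvalues   *)
(* of the pencil A - z B (B invertible).                                      *)
Definition pencil_eigenvalues (R : realType) (n : nat) (A B : 'M[R[i]]_n)
    (lam : seq R) : Prop :=
  sorted (fun s t : R => t <= s) lam /\
  \det ('X *: map_mx polyC B - map_mx polyC A) =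
    (\det B)%:P * \prod_(t <- lam) ('X - (t%:C)%:P).

(* Main.v *)
Require Import Defs.
From HB Require Import structures.
From mathcomp Require Import all_boot all_order all_algebra complex.
From mathcomp Require Import all_classical all_reals all_analysis.
From mathcomp Require Import ring zify.

(** Write [psi_i] for the centered features divided by the square root of [n],
[Z v] for the combination of the [psi_i] with coefficients [v] (synthesis),
[Zs h] for the inner products of [h] with the [psi_i] (analysis). Then [Zs]
is the adjoint of [Z], [Zs (Z v) = K *m v] for the centered Gram matrix [K],
the covariance is [Z Zs], and the empirical Toeplitz operator is [Z T Zs]
([emp_W_toeplitz]): lag [j] fills the [j]-th diagonal of [T]. With
[Q] the inverse square root of [Z Zs + gamma], the operator to truncate is
[B = Q Z T Zs]; everything about it can be computed with n by n matrices.

Since [(Z Zs + gamma) Z = Z Kg] with [Kg = K + gamma], the vectors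
[whiten u = Q Z Kg u] satisfy [Q (whiten u) = Z u] and have Gram form
[v^H K Kg u]. A column [u] that solves the generalized eigenvalue problem with
eigenvalue [sigma^2] makes [whiten u] a left singular vector of [B] with
singular value [sigma]. To know that the columns of [U] are the leading ones,
the problem is made Hermitian: with [L = K^(1/2) Kg^(-1/2)] the matrix
[A = L T K T^H L] has the eigenvalues of the pencil, with multiplicity, and
the vectors [K^(1/2) Kg^(1/2) u_i] are orthonormal eigenvectors of it.
They extend to a full ordered eigenbasis ([eigenbasis_extension]), which is
carried back to a family of pencil eigenvectors ([pencil_eigenbasis]) and then
to a complete singular value decomposition of [B] that starts with [U]
([whitened_op_leading_svd]).

An [r]-truncation does not depend on the decomposition unless two singular
values coincide at the cut ([svd_truncation_unique]); in case of such a tie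
the vectors attached to [U] are the chosen ones. So in all cases
[G = Q [[B]]_r] is the orthogonal projection of [B] on the [whiten u_i],
followed by [Q]: [G = Z U (U^H K T Zs)] ([whitened_op_truncation]). This is a
product [X Y] with [Y X = V^H T V] where [V = K U]. Hence right eigenvectors
[w] of the small matrix give right eigenfunctions [Z U w] of [G], its
generalized eigenspaces for nonzero eigenvalues correspond to those of [G]
([factored_alg_multiplicity]), and the adjoint [Z (T^H K U) U^H Zs] gives the
left eigenfunctions.

If [F] is self-adjoint, it also has the adjoint symbol, since taking adjoints
exchanges the powers of the transfer operator with those of its adjoint and
conjugates the coefficients. By the separation hypothesis the coefficients in
[T] then agree with those of the adjoint symbol, so [T] is Hermitian, so
is [V^H T V], and its eigenvalues are real; the skew-adjoint case differs by a
sign. *)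

Set Implicit Arguments.
Unset Strict Implicit.
Unset Printing Implicit Defensive.
Import Order.TTheory GRing.Theory Num.Theory.

Local Open Scope classical_set_scope.
Local Open Scope ring_scope.
Local Open Scope complex_scope.

(** * Conjugate transposes, characteristic polynomials, Hermitian eigenbases *)

Lemma ctmxM (C : numClosedFieldType) m n p (A : 'M[C]_(m, n)) (B : 'M[C]_(n, p)) :
  (A *m B)^H = B^H *m A^H.
Proof. by rewrite trmx_mul map_mxM. Qed.

Lemma ctmxK (C : numClosedFieldType) m n (A : 'M[C]_(m, n)) : (A^H)^H = A.
Proof. by apply/matrixP => i j; rewrite !mxE conjCK. Qed.

Lemma ctmx1 (C : numClosedFieldType) n : (1%:M : 'M[C]_n)^H = 1%:M.
Proof. by rewrite trmx1 map_mx1. Qed.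

Lemma ctmxB (C : numClosedFieldType) m n (A B : 'M[C]_(m, n)) :
  (A - B)^H = A^H - B^H.
Proof. by apply/matrixP => i j; rewrite !mxE rmorphB. Qed.

Lemma ctmxZ (C : numClosedFieldType) m n (a : C) (A : 'M[C]_(m, n)) :
  (a *: A)^H = a^_* *: A^H.
Proof. by apply/matrixP => i j; rewrite !mxE rmorphM. Qed.

Lemma ctmx_mul_eq0 (C : numClosedFieldType) m n (A : 'M[C]_(m, n)) :
  A^H *m A = 0 -> A = 0.
Proof.
move=> AA0; apply/matrixP => i j; rewrite mxE; apply/eqP.
have /matrixP/(_ j j) := AA0; rewrite !mxE => /eqP.
rewrite psumr_eq0 => [/allP/(_ i (mem_index_enum _))|i' _]; last first.
  by rewrite !mxE mulrC mul_conjC_ge0.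
by rewrite !mxE mulf_eq0 conjC_eq0 orbb.
Qed.

Lemma ctmx_diag (C : numClosedFieldType) n (d : 'rV[C]_n) :
  (forall i, (d 0 i)^_* = d 0 i) -> (diag_mx d)^H = diag_mx d.
Proof.
move=> dR; apply/matrixP => i j; rewrite !mxE eq_sym; case: eqP => [->|_].
  by rewrite !mulr1n dR.
by rewrite !mulr0n conjC0.
Qed.

Lemma ctmx_mul_diag_ge0 (C : numClosedFieldType) m n (Y : 'M[C]_(m, n)) (d : 'rV[C]_n) :
  Y^H *m Y = diag_mx d -> forall i, 0 <= d 0 i.
Proof.
move=> YY i; have /matrixP/(_ i i) := YY; rewrite !mxE eqxx mulr1n => <-.
by apply: sumr_ge0 => j _; rewrite !mxE mulrC mul_conjC_ge0.
Qed.

Lemma eq_col (C : Type) m n (A B : 'M[C]_(m, n)) :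
  (forall j, col j A = col j B) -> A = B.
Proof. by move=> AB; apply/matrixP => i j; have /colP/(_ i) := AB j; rewrite !mxE. Qed.

Lemma col_mulmx (C : nzRingType) m n p (A : 'M[C]_(m, n)) (B : 'M[C]_(n, p)) j :
  col j (A *m B) = A *m col j B.
Proof. by rewrite !colE mulmxA. Qed.

Lemma ctmx_shift (C : numClosedFieldType) n (K : 'M[C]_n) (g : C) :
  K^H = K -> g^_* = g -> (K + g%:M)^H = K + g%:M.
Proof.
move=> Kh gR; have -> : (K + g%:M)^H = K^H + (g%:M)^H.
  by apply/matrixP => i j; rewrite !mxE rmorphD.
rewrite Kh; congr (_ + _); apply/matrixP => i j; rewrite !mxE eq_sym.
by case: eqP; rewrite ?mulr1n ?mulr0n ?conjC0.
Qed.

Lemma ctmx_congruence (C : numClosedFieldType) m n (T : 'M[C]_n)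
    (V : 'M[C]_(n, m)) (e : C) :
  T^H = e *: T -> (V^H *m T *m V)^H = e *: (V^H *m T *m V).
Proof.
by move=> Te; rewrite !ctmxM ctmxK Te -scalemxAl -scalemxAr mulmxA.
Qed.

Lemma col_mul_diag (C : comNzRingType) m n (X : 'M[C]_(m, n)) (d : 'rV[C]_n) j :
  col j (X *m diag_mx d) = d 0 j *: col j X.
Proof. by apply/colP => i; rewrite mul_mx_diag !mxE mulrC. Qed.

Lemma ctm_col_entry (C : numClosedFieldType) m n p q (A : 'M[C]_(m, p)) (M : 'M[C]_(m, n))
    (B : 'M[C]_(n, q)) i j :
  ((col i A)^H *m M *m col j B) 0 0 = (A^H *m M *m B) i j.
Proof.
rewrite !colE ctmxM trmx_delta map_delta_mx !mulmxA -colE -!mulmxA -rowE !mxE //.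
Qed.

Lemma mul_ctm_sum (C : numClosedFieldType) m n (U : 'M[C]_(n, m)) (K T : 'M[C]_n)
    (y : 'cV[C]_n) :
  U *m (U^H *m K *m T *m y) = \sum_j ((col j U)^H *m K *m T *m y) 0 0 *: col j U.
Proof.
apply/colP => k; rewrite mxE summxE; apply: eq_bigr => j _.
rewrite [RHS]mxE [X in _ = _ * X]mxE mulrC; congr (_ * _).
rewrite -!(mulmxA _ K T) -ctm_col_entry; congr ((_ *m _) _ _).
by apply/colP => l; rewrite mxE.
Qed.

(** With [e = 1] the eigenvalues of a Hermitian matrix are real, with [e = -1]
    those of a skew-Hermitian one are imaginary: compare [w^H N w] with its
    conjugate. *)
Lemma sign_eigenvalue (C : numClosedFieldType) r (N : 'M[C]_r) (e nu : C) (w : 'cV[C]_r) :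
  N^H = e *: N -> N *m w = nu *: w -> w != 0 -> nu^_* = e * nu.
Proof.
move=> Nh Nw w0; have ww : (w^H *m w) 0 0 != 0.
  apply: contra w0 => /eqP ww; apply/eqP/ctmx_mul_eq0.
  by rewrite [LHS]mx11_scalar ww raddf0.
apply: (mulIf ww).
have : (w^H *m N^H) *m w = w^H *m (N^H *m w) by rewrite mulmxA.
rewrite -ctmxM Nw ctmxZ Nh -!scalemxAl Nw -!scalemxAr scalerA.
by move/matrixP/(_ 0 0); rewrite [LHS]mxE [RHS]mxE.
Qed.

Lemma pencil_orthogonal (C : numClosedFieldType) n (S P : 'M[C]_n) (a b : C)
    (u v : 'cV[C]_n) :
  S^H = S -> P^H = P -> a^_* = a -> a != b ->
  S *m u = a *: (P *m u) -> S *m v = b *: (P *m v) -> u^H *m P *m v = 0.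
Proof.
move=> Sh Ph aR ab Su Sv.
have := congr1 (fun y => y^H *m v) Su; rewrite ctmxZ !ctmxM Sh Ph aR.
rewrite -mulmxA Sv -scalemxAr -scalemxAl mulmxA => /eqP.
rewrite eq_sym -subr_eq0 -scalerBl scaler_eq0 subr_eq0 (negbTE ab) => /eqP //.
Qed.

(** Both sides are the determinant of one block matrix with blocks ['X], [A],
    [B], [1], up to the factor [\det 'X], which is cancelled; neither matrix
    has to be invertible. *)
Lemma char_poly_mulC (F : fieldType) n (A B : 'M[F]_n) :
  char_poly (A *m B) = char_poly (B *m A).
Proof.
rewrite /char_poly /char_poly_mx !map_mxM.
set a := map_mx polyC A; set b := map_mx polyC B.
pose M := block_mx ('X%:M) a b 1%:M : 'M[{poly F}]_(n + n).
have e1 : \det M = \det ('X%:M - a *m b).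
  have := det_mulmx M (block_mx 1%:M 0 (- b) 1%:M).
  rewrite mulmx_block det_lblock !det1 !mulr1 => <-.
  by rewrite !mulmx1 !mulmx0 !mul1mx !add0r mulmxN subrr det_ublock det1 mulr1.
(* Multiplication on the left by the block matrix with rows [1, 0] and [-B, 'X]
   makes [M] block triangular. *)
have e2 : \det ('X%:M : 'M[_]_n) * \det M =
          \det ('X%:M : 'M[_]_n) * \det ('X%:M - b *m a).
  have := det_mulmx (block_mx 1%:M 0 (- b) 'X%:M) M.
  rewrite mulmx_block det_lblock !det1 !mul1r => <-.
  rewrite !mul1mx !mul0mx !addr0 mulmx1 mulNmx -scalar_mxC mul_mx_scalar.
  by rewrite addNr det_ublock mulNmx addrC.
rewrite -e1; move/mulfI: e2; apply.
by rewrite det_scalar expf_neq0 // polyX_eq0.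
Qed.

Lemma char_poly_similar (F : fieldType) n (A B S : 'M[F]_n) :
  B *m S = 1%:M -> char_poly (S *m A *m B) = char_poly A.
Proof. by move=> BS; rewrite char_poly_mulC mulmxA BS mul1mx. Qed.

Lemma char_poly_diag (F : fieldType) n (d : 'rV[F]_n) :
  char_poly (diag_mx d) = \prod_i ('X - (d 0 i)%:P).
Proof.
rewrite char_poly_trig ?diag_mx_is_trig //.
by apply: eq_bigr => i _; rewrite mxE eqxx mulr1n.
Qed.

(** Gram-Schmidt applied to a basis of the orthogonal complement, whose
    dimension is [s]. *)
Lemma unitary_completion (C : numClosedFieldType) r s (c : 'M[C]_(r + s, r)) :
  c^H *m c = 1%:M ->
  exists c' : 'M[C]_(r + s, s), c'^H *m c' = 1%:M /\ c^H *m c' = 0.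
Proof.
move=> cc; pose b := c^H.
have bu : b \is unitarymx by apply/unitarymxP; rewrite -[X in _ *m X]/(b^H) ctmxK.
have rk : \rank (orthomx (@Num.conj C) 1%:M b) = s.
  by rewrite rank_ortho mxrank_unitary // addKn.
set O := orthomx _ _ _ in rk.
have [y yu yO] : exists2 y : 'M[C]_(s, r + s), y *m y^H = 1%:M & (y <= O)%MS.
  have Su : schmidt (row_base O) \is unitarymx.
    by rewrite schmidt_unitarymx // rank_leq_col.
  have SO : (schmidt (row_base O) <= O)%MS.
    by rewrite eqmx_schmidt_free ?row_base_free // eq_row_base.
  move: (schmidt _) (unitarymxP Su) SO; rewrite rk => y yu yO.
  by exists y.
have yb : y *m b^H = 0.
  by move: yO => /(orthomx1P); rewrite /b.
exists y^H; rewrite !ctmxK; split=> //.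
rewrite -[LHS]ctmxK ctmxM !ctmxK -[c](ctmxK) yb.
by apply/matrixP => i j; rewrite !mxE conjC0.
Qed.

Lemma ex_normalized (C : numClosedFieldType) n (u : 'cV[C]_n) : u != 0 ->
  exists a : C, (a *: u)^H *m (a *: u) = 1%:M.
Proof.
move=> u0; pose t := (u^H *m u) 0 0.
have t_ge0 : 0 <= t.
  by rewrite /t mxE; apply: sumr_ge0 => i _; rewrite !mxE mulrC mul_conjC_ge0.
have uE : u^H *m u = t%:M by rewrite [LHS]mx11_scalar.
have t0 : t != 0.
  by apply: contra u0 => /eqP t0; apply/eqP/ctmx_mul_eq0; rewrite uE t0 raddf0.
exists (sqrtC t)^-1; rewrite ctmxZ -scalemxAl -scalemxAr uE scalerA.
have sR : ((sqrtC t)^-1)^_* = (sqrtC t)^-1.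
  by rewrite geC0_conj // invr_ge0 sqrtC_ge0.
by rewrite sR -invfM -expr2 sqrtCK scale_scalar_mx mulVf.
Qed.

(** In a unitary basis that starts with [c], [A] is block diagonal. The first
    block takes up the roots [lam_0, ..., lam_(r-1)] of the characteristic
    polynomial, so [lam_r] is an eigenvalue of the second block. *)
Lemma hermitian_next_eigenvector (C : numClosedFieldType) r s (A : 'M[C]_(r + s.+1))
    (lam : seq C) (c : 'M[C]_(r + s.+1, r)) :
  (forall i, (lam`_i)^_* = lam`_i) ->
  A^H = A -> char_poly A = \prod_(t <- lam) ('X - t%:P) ->
  c^H *m c = 1%:M -> A *m c = c *m diag_mx (\row_i lam`_i) ->
  exists v : 'cV[C]_(r + s.+1),
    [/\ v^H *m v = 1%:M, c^H *m v = 0 & A *m v = lam`_r *: v].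
Proof.
move=> lamR Ah Alam cc Ac; set Lam := diag_mx _ in Ac.
have slam : size lam = (r + s.+1)%N.
  have := size_char_poly A; rewrite Alam size_prod_XsubC => -[].
  by [].
have [c' [c'c' cc']] := unitary_completion cc.
(* [row_mx c c'] is a unitary basis in which [A] is block diagonal. *)
have c'c : c'^H *m c = 0.
  rewrite -[LHS]ctmxK ctmxM ctmxK cc'.
  by apply/matrixP => i j; rewrite !mxE conjC0.
have XX : (row_mx c c')^H *m row_mx c c' = 1%:M.
  by rewrite tr_row_mx map_col_mx mul_col_row cc cc' c'c c'c' -scalar_mx_block.
have XX' := mulmx1C XX.
have cAc' : c^H *m A *m c' = 0.
  by rewrite -[c^H *m A]ctmxK ctmxM ctmxK Ah Ac ctmxM -mulmxA cc' mulmx0.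
have cpC : char_poly A = char_poly Lam * char_poly (c'^H *m A *m c').
  rewrite -(@char_poly_similar _ _ A (row_mx c c') (row_mx c c')^H) //.
  rewrite tr_row_mx map_col_mx mul_col_mx mul_col_row.
  rewrite -!mulmxA Ac !mulmxA cc c'c mul1mx mul0mx cAc'.
  rewrite /char_poly /char_poly_mx map_block_mx scalar_mx_block opp_block_mx.
  rewrite add_block_mx !raddf0 !addr0.
  by rewrite det_ublock.
(* The first block has eigenvalues [take r lam]; cancel its factor. *)
have cpL : char_poly (c'^H *m A *m c') =
           \prod_(t <- drop r lam) ('X - t%:P).
  have cp0 : char_poly Lam != 0 by rewrite monic_neq0 // char_poly_monic.
  apply: (mulfI cp0); rewrite -cpC Alam -{1}(cat_take_drop r lam) big_cat /=.
  congr (_ * _); rewrite char_poly_diag.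
  have -> : take r lam = [seq lam`_(i : nat) | i : 'I_r].
    apply: (@eq_from_nth _ 0).
      by rewrite size_takel ?slam ?leq_addr // size_map size_enum_ord.
    move=> j; rewrite size_takel ?slam ?leq_addr // => jr.
    rewrite nth_take // (nth_map (Ordinal jr)) ?size_enum_ord //.
    by rewrite nth_enum_ord.
  by rewrite big_map enumT; apply: eq_bigr => i _; rewrite mxE.
have : eigenvalue (c'^H *m A *m c') lam`_r.
  rewrite eigenvalue_root_char cpL (drop_nth 0) ?slam ?addnS ?ltnS ?leq_addr //.
  by rewrite big_cons rootM root_XsubC eqxx.
move=> /eigenvalueP [y yA y0].
have {}yA : c'^H *m A *m c' *m y^H = lam`_r *: y^H.
  have Mh : (c'^H *m A *m c')^H = c'^H *m A *m c'.
    by rewrite !ctmxM ctmxK Ah mulmxA.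
  by rewrite -[in LHS]Mh -ctmxM yA ctmxZ lamR.
have AW : A *m c' = c' *m (c'^H *m A *m c').
  rewrite -[LHS]mul1mx -XX' tr_row_mx map_col_mx mul_row_col mulmxDl.
  by rewrite -!mulmxA [c^H *m _]mulmxA cAc' mulmx0 add0r !mulmxA.
have u0 : c' *m y^H != 0.
  apply: contraNneq y0 => cy0; rewrite -[y]ctmxK -[y^H]mul1mx -c'c' -mulmxA cy0.
  by rewrite mulmx0; apply/eqP/matrixP => i j; rewrite !mxE conjC0.
have [a au] := ex_normalized u0; exists (a *: (c' *m y^H)); split=> //.
  by rewrite -scalemxAr mulmxA cc' mul0mx scaler0.
rewrite -scalemxAr mulmxA AW -[c' *m _ *m _]mulmxA yA -scalemxAr !scalerA.
by rewrite [a * _]mulrC.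
Qed.

(** Given orthonormal eigenvectors for a prefix of the list of eigenvalues can be
    kept as the beginning of an eigenbasis that follows the order of the list,
    whatever the multiplicities: add one eigenvector at a time. *)
Lemma eigenbasis_extension (C : numClosedFieldType) s r n (A : 'M[C]_n) (lam : seq C)
    (c : 'M[C]_(n, r)) :
  n = (r + s)%N ->
  (forall i, (lam`_i)^_* = lam`_i) ->
  A^H = A -> char_poly A = \prod_(t <- lam) ('X - t%:P) ->
  c^H *m c = 1%:M -> A *m c = c *m diag_mx (\row_i lam`_i) ->
  exists W : 'M[C]_n,
    [/\ W^H *m W = 1%:M, A *m W = W *m diag_mx (\row_i lam`_i) &
        forall (i : 'I_r) (j : 'I_n), i = j :> nat -> col j W = col i c].
Proof.
move=> + lamR; elim: s r c => [|s IHs] r c nE Ah Alam cc Ac.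
  rewrite addn0 in nE; case: r / nE c cc Ac => c cc Ac.
  by exists c; split=> // i j /val_inj ->.
have [v [vv cv Av]] : exists v : 'cV[C]_n,
    [/\ v^H *m v = 1%:M, c^H *m v = 0 & A *m v = lam`_r *: v].
  move: c cc Ac {IHs}; subst n => c cc Ac.
  exact: hermitian_next_eigenvector lamR Ah Alam cc Ac.
have vc : v^H *m c = 0.
  rewrite -[LHS]ctmxK ctmxM ctmxK cv.
  by apply/matrixP => i j; rewrite !mxE conjC0.
have dE : \row_(i < r + 1) lam`_i =
    row_mx (\row_(i < r) lam`_i) (\row_(_ < 1) lam`_r) :> 'rV[C]_(r + 1).
  apply/rowP => i; rewrite !mxE; case: splitP => j ij; rewrite mxE ij //.
  by rewrite ord1 addn0.
have [] := IHs (r + 1)%N (row_mx c v) _ Ah Alam.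
- by rewrite nE addn1 addSnnS.
- by rewrite tr_row_mx map_col_mx mul_col_row cc cv vc vv -scalar_mx_block.
- rewrite mul_mx_row Ac Av dE diag_mx_row mul_row_block !mulmx0 addr0 add0r.
  congr row_mx; apply/colP => i; rewrite !mxE big_ord1 !mxE mulr1n mulrC //.
move=> W [WW AW cW]; exists W; split=> // i j ij.
rewrite (cW (lshift 1 i) j) //; apply/colP => k.
by rewrite mxE row_mxEl mxE.
Qed.

(** * Functions of a Hermitian matrix *)

Section SpectralCalculus.
Context (C : numClosedFieldType) (n : nat) (P : 'M[C]_n) (d : 'rV[C]_n).
Implicit Types f g : C -> C.

(** Functional calculus: [f] of the matrix with unitary diagonalization [P, d]. *)
Definition mxfun f : 'M[C]_n :=
  P^H *m diag_mx (\row_i f (d 0 i)) *m P.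

Lemma eq_mxfun f g : (forall i, f (d 0 i) = g (d 0 i)) -> mxfun f = mxfun g.
Proof.
move=> fg; rewrite /mxfun; congr (_ *m diag_mx _ *m _).
by apply/rowP => i; rewrite !mxE fg.
Qed.

Lemma mxfun_ct f : (forall i, (f (d 0 i))^_* = f (d 0 i)) ->
  (mxfun f)^H = mxfun f.
Proof.
move=> fR; rewrite /mxfun !ctmxM ctmxK mulmxA; congr (_ *m _ *m _).
apply/matrixP => i j; rewrite !mxE eq_sym; case: eqP => [->|_].
  by rewrite !mulr1n fR.
by rewrite !mulr0n conjC0.
Qed.

Lemma mxfunD f g : mxfun f + mxfun g = mxfun (fun t => f t + g t).
Proof.
rewrite /mxfun -mulmxDl -mulmxDr -raddfD; congr (_ *m diag_mx _ *m _).
by apply/rowP => i; rewrite !mxE.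
Qed.

Lemma mxfunZ (t : C) f : t *: mxfun f = mxfun (fun u => t * f u).
Proof.
rewrite /mxfun scalemxAl scalemxAr -linearZ; congr (_ *m diag_mx _ *m _).
by apply/rowP => i; rewrite !mxE.
Qed.

Hypothesis PP : P *m P^H = 1%:M.

Lemma mxfunM f g : mxfun f *m mxfun g = mxfun (fun t => f t * g t).
Proof.
rewrite /mxfun !mulmxA -[_ *m P *m P^H]mulmxA PP mulmx1.
rewrite -[_ *m diag_mx _ *m diag_mx _]mulmxA.
rewrite mulmx_diag; congr (_ *m diag_mx _ *m _).
by apply/rowP => i; rewrite !mxE.
Qed.

Lemma mxfun_cst t : mxfun (fun=> t) = t%:M.
Proof.
rewrite /mxfun; have -> : \row_(i < n) t = const_mx t :> 'rV[C]_n.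
  by apply/rowP => i; rewrite !mxE.
by rewrite diag_const_mx mul_mx_scalar -scalemxAl (mulmx1C PP) scalemx1.
Qed.

End SpectralCalculus.

Lemma hermitian_mxfun (C : numClosedFieldType) n (K : 'M[C]_n) : K^H = K ->
  exists P (d : 'rV[C]_n), P *m P^H = 1%:M /\ K = mxfun P d id.
Proof.
move=> Kh.
have hK : K \is hermsymmx by apply/is_hermitianmxP; rewrite expr0 scale1r Kh.
have /orthomx_spectralP KE := hermitian_normalmx hK.
have Pu := spectral_unitarymx K.
exists (spectralmx K), (spectral_diag K); split; first exact/unitarymxP.
rewrite [LHS]KE /mxfun invmx_unitary //; congr (_ *m diag_mx _ *m _).
by apply/rowP => i; rewrite !mxE.
Qed.

(** Evaluate the quadratic form at the eigenvectors. *)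
Lemma psd_spectrum_ge0 (C : numClosedFieldType) n (P : 'M[C]_n) (d : 'rV[C]_n) :
  P *m P^H = 1%:M ->
  (forall u : 'cV[C]_n, 0 <= (u^H *m mxfun P d id *m u) 0 0) ->
  forall i, 0 <= d 0 i.
Proof.
move=> PP psd i; have := psd (P^H *m delta_mx i 0).
rewrite ctmxM ctmxK /mxfun !mulmxA -[_ *m P *m P^H]mulmxA PP mulmx1.
rewrite -[_ *m P *m P^H]mulmxA PP mulmx1.
rewrite -mulmxA mul_diag_mx mxE (bigD1 i) //= big1 ?addr0 => [|j ji].
  by rewrite !mxE !eqxx conjC1 mul1r mulr1.
by rewrite !mxE (negbTE ji) mulr0 mulr0.
Qed.

(** * Finite families in a Hilbert space and the inverse square root *)

Section InnerProduct.
Context (C : numClosedFieldType) (H : lmodType C) (ip : {dot H for @Num.conj C}).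

Lemma ipC u v : ip u v = (ip v u)^_*.
Proof. by rewrite hermC expr0 mul1r. Qed.

Lemma ip_eq0 u : ip u u = 0 -> u = 0.
Proof.
move=> uu; apply/eqP; apply: contraT => /(@neq0_dnorm_gt0 _ _ _ ip).
by rewrite uu ltxx.
Qed.

Lemma ip_ge0 u : 0 <= ip u u.
Proof.
have [->|u0] := eqVneq u 0; first by rewrite linear0l.
exact/ltW/neq0_dnorm_gt0.
Qed.

Lemma ip_inj u v : (forall z, ip z u = ip z v) -> u = v.
Proof.
move=> uv; apply/eqP; rewrite -subr_eq0; apply/eqP/ip_eq0.
by rewrite linearB /= uv subrr.
Qed.

End InnerProduct.

(** Isolated over an abstract ring because it is the product rule of the
    operator calculus below. *)
Lemma mulmx_resolvent (C : comNzRingType) n (F K G : 'M[C]_n) (a : C) (z : 'cV[C]_n) :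
  F *m (a *: z + K *m (G *m z)) = (a *: F + F *m K *m G) *m z.
Proof. by rewrite mulmxDr mulmxDl -scalemxAr -scalemxAl !mulmxA. Qed.

Section Frame.
Context (C : numClosedFieldType) (H : lmodType C) (ip : {dot H for @Num.conj C}).
Context (n : nat) (psi : 'I_n -> H).

Definition synthesis (v : 'cV[C]_n) : H := \sum_i v i 0 *: psi i.
Definition analysis (h : H) : 'cV[C]_n := \col_i ip h (psi i).
Definition frame_gram : 'M[C]_n := \matrix_(i, j) ip (psi j) (psi i).

Fact synthesis_linear : linear synthesis.
Proof.
move=> a u v; rewrite /synthesis scaler_sumr -big_split /=.
by apply: eq_bigr => i _; rewrite !mxE scalerDl scalerA.
Qed.
HB.instance Definition _ := GRing.isLinear.Build _ _ _ _ synthesis synthesis_linear.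

Fact analysis_linear : linear analysis.
Proof.
by move=> a u v; apply/colP => i; rewrite !mxE linearPl.
Qed.
HB.instance Definition _ := GRing.isLinear.Build _ _ _ _ analysis analysis_linear.

Lemma synthesisD u v : synthesis (u + v) = synthesis u + synthesis v.
Proof. exact: linearD. Qed.
Lemma synthesisZ a v : synthesis (a *: v) = a *: synthesis v.
Proof. exact: linearZ. Qed.
Lemma analysisD u v : analysis (u + v) = analysis u + analysis v.
Proof. exact: linearD. Qed.
Lemma analysisZ a v : analysis (a *: v) = a *: analysis v.
Proof. exact: linearZ. Qed.

Local Notation Z := synthesis.
Local Notation Zs := analysis.
Local Notation K := frame_gram.

Lemma ip_synthesisr h v : ip h (Z v) = (v^H *m Zs h) 0 0.
Proof.
rewrite /synthesis linear_sumr mxE; apply: eq_bigr => i _.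
by rewrite linearZr_LR !mxE.
Qed.

Lemma ip_synthesisl h v : ip (Z v) h = ((Zs h)^H *m v) 0 0.
Proof.
rewrite ipC ip_synthesisr -[in RHS](ctmxK v) -ctmxM.
by rewrite [in RHS]mxE [in RHS]mxE.
Qed.

Lemma analysis_synthesis v : Zs (Z v) = K *m v.
Proof.
apply/colP => i; rewrite !mxE /synthesis linear_sumlz; apply: eq_bigr => j _.
by rewrite linearZl_LR mxE mulrC.
Qed.

Lemma frame_gram_herm : K^H = K.
Proof. by apply/matrixP => i j; rewrite !mxE -ipC. Qed.

Lemma frame_gram_psd (u : 'cV[C]_n) : 0 <= (u^H *m K *m u) 0 0.
Proof. by rewrite -mulmxA -analysis_synthesis -ip_synthesisr ip_ge0. Qed.

(** The squared norm of [Z v] is the quadratic form of the Gram matrix at [v]. *)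
Lemma synthesis_eq0 v : K *m v = 0 -> Z v = 0.
Proof.
move=> Kv; apply: (@ip_eq0 _ _ ip).
by rewrite ip_synthesisr analysis_synthesis Kv mulmx0 mxE.
Qed.

Section Calculus.
Context (P : 'M[C]_n) (d : 'rV[C]_n).
Hypotheses (PP : P *m P^H = 1%:M) (KE : K = mxfun P d id).

Lemma gram_spectrum_ge0 i : 0 <= d 0 i.
Proof.
by apply: (psd_spectrum_ge0 PP) => u; rewrite -KE frame_gram_psd.
Qed.

(** Functional calculus for the operator [Z Zs], reduced to that of the matrix
    [K = Zs Z]: since [f (Z Zs) = Z (f K) Zs] for the values away from zero,
    [e] is split into the constant [e 0] and [t * ((e t - e 0) / t)]. At an
    eigenvalue [t = 0] the quotient is [0], and any other value would define
    the same operator since [Z] kills the kernel of [K]. *)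
Definition opfun (e : C -> C) (h : H) : H :=
  (e 0) *: h + Z (mxfun P d (fun t => (e t - e 0) / t) *m Zs h).

Fact opfun_linear e : linear (opfun e).
Proof.
move=> a u v; rewrite /opfun analysisD analysisZ mulmxDr -scalemxAr.
rewrite synthesisD synthesisZ.
by rewrite !scalerDr !scalerA [a * _]mulrC !addrA; congr (_ + _); rewrite addrAC.
Qed.

Lemma eq_opfun e f : e 0 = f 0 -> (forall i, e (d 0 i) = f (d 0 i)) ->
  opfun e =1 opfun f.
Proof.
move=> ef0 ef h; rewrite /opfun ef0.
by rewrite (@eq_mxfun _ _ P d _ (fun t => (f t - f 0) / t)) // => i; rewrite ef.
Qed.

Lemma opfun_sa e f g : (e 0)^_* = e 0 ->
  (forall i, (e (d 0 i))^_* = e (d 0 i)) -> ip (opfun e f) g = ip f (opfun e g).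
Proof.
move=> e0R eR; rewrite /opfun linearDl linearDr linearZl_LR linearZr_LR /= e0R.
congr (_ + _).
rewrite ip_synthesisl ip_synthesisr ctmxM mxfun_ct ?mulmxA // => i.
rewrite rmorphM fmorphV rmorphB /= eR e0R conj_Creal //.
by rewrite ger0_real // gram_spectrum_ge0.
Qed.

(** [Zs Z = K] turns the product of the two finite-rank parts into a single
    function of [K]. *)
Lemma opfunM e f h : opfun e (opfun f h) = opfun (fun t => e t * f t) h.
Proof.
rewrite /opfun analysisD analysisZ analysis_synthesis KE; move: (Zs h) => z.
set F := mxfun P d (fun t => (e t - e 0) / t).
set G := mxfun P d (fun t => (f t - f 0) / t).
rewrite mulmx_resolvent scalerDr scalerA -addrA -synthesisZ -synthesisD.
rewrite scalemxAl -mulmxDl.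
congr (_ + Z (_ *m z)); rewrite !mxfunM // !mxfunZ !mxfunD; apply: eq_mxfun => i.
have [->|d0] := eqVneq (d 0 i) 0; first by rewrite invr0 !(mulr0, mul0r, addr0).
by field.
Qed.

Lemma opfun1 h : opfun (fun=> 1) h = h.
Proof.
rewrite /opfun (@eq_mxfun _ _ P d _ (fun=> 0)); last by move=> i; rewrite subrr mul0r.
by rewrite mxfun_cst // raddf0 mul0mx linear0 addr0 scale1r.
Qed.

(** The quotient that represents [t + c] is [1] except on the kernel of [K],
    which [Z] annihilates. *)
Lemma opfun_shift (c : C) h : opfun (fun t => t + c) h = c *: h + Z (Zs h).
Proof.
rewrite /opfun add0r; congr (_ + _); apply/eqP; rewrite -subr_eq0 -linearB /=.
apply/eqP/synthesis_eq0; rewrite mulmxBr mulmxA KE mxfunM //.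
rewrite (@eq_mxfun _ _ P d _ id) ?subrr // => i.
have [->|d0] := eqVneq (d 0 i) 0; first by rewrite mul0r.
by field.
Qed.

End Calculus.

(** Take [e t = (t + c)^(-1/2)]; positivity holds because [e] is the square of
    a real function. *)
Lemma ex_inv_sqrt_shifted_frame (c : C) (A : H -> H) : 0 < c ->
  (forall h, A h = c *: h + Z (Zs h)) ->
  exists Q : H -> H, [/\ linear Q, forall f g, ip (Q f) g = ip f (Q g),
    forall h, 0 <= ip (Q h) h,
    forall h, Q (Q (A h)) = h & forall h, A (Q (Q h)) = h].
Proof.
move=> c0 AE; have [P [d [PP KE]]] := hermitian_mxfun frame_gram_herm.
have dc t : 0 <= t -> 0 < t + c by move=> t0; rewrite ltr_wpDl.
have d0 := gram_spectrum_ge0 PP KE.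
pose q t := (sqrtC (t + c))^-1.
have qqE t : 0 <= t -> q t * (q t * (t + c)) = 1.
  move=> t0; have tc := dc t t0; rewrite mulrA /q -invfM -expr2 sqrtCK.
  by rewrite mulVf // gt_eqF.
have q_ge0 t : 0 <= t -> 0 <= q t.
  by move=> t0; rewrite invr_ge0 sqrtC_ge0 ltW ?dc.
exists (opfun P d q); split.
- exact: opfun_linear.
- by move=> f g; rewrite opfun_sa // => [|i]; rewrite geC0_conj ?q_ge0.
- move=> h; rewrite -(@eq_opfun P d (fun t => sqrtC (q t) * sqrtC (q t))).
  + rewrite -opfunM // opfun_sa ?ip_ge0 // => [|i];
    by rewrite geC0_conj ?sqrtC_ge0 ?q_ge0.
  + by rewrite -expr2 sqrtCK.
  + by move=> i; rewrite -expr2 sqrtCK.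
- move=> h; rewrite AE -(opfun_shift PP KE) !opfunM // -[RHS](opfun1 d PP).
  by apply: eq_opfun => [|i]; rewrite -mulrA qqE.
- move=> h; rewrite AE -(opfun_shift PP KE) !opfunM // -[RHS](opfun1 d PP).
  by apply: eq_opfun => [|i]; rewrite -mulrA mulrC -mulrA qqE.
Qed.

End Frame.

Section Operators.
Context (R : realType) (H : lmodType R[i]) (ip : {dot H for @Num.conj R[i]}).

Lemma adjointE (A B : H -> H) :
  (forall f g, ip (A f) g = ip f (B g)) -> adjoint ip A = B.
Proof.
move=> AB; have : [set B' | forall f g, ip (A f) g = ip f (B' g)] (adjoint ip A).
  by apply: xgetPex; exists B.
by move=> /= AB'; apply/funext => g; apply: (@ip_inj _ _ ip) => z; rewrite -AB' AB.
Qed.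

(** [inv_sqrt] is a choice among the operators with its defining properties, so
    the existence of one such operator gives them. *)
Lemma inv_sqrt_shifted_frame n (psi : 'I_n -> H) (c : R) (A : H -> H) : 0 < c ->
  (forall h, A h = c%:C *: h + synthesis psi (analysis ip psi h)) ->
  [/\ linear (inv_sqrt ip A),
      forall f g, ip (inv_sqrt ip A f) g = ip f (inv_sqrt ip A g),
      forall h, inv_sqrt ip A (inv_sqrt ip A (A h)) = h &
      forall h, A (inv_sqrt ip A (inv_sqrt ip A h)) = h].
Proof.
move=> c0 AE; have c0' : 0 < c%:C by rewrite ltcR.
suff : [set Q | [/\ linear Q, forall f g, ip (Q f) g = ip f (Q g),
    forall h, 0 <= ip (Q h) h,
    forall h, Q (Q (A h)) = h & forall h, A (Q (Q h)) = h]] (inv_sqrt ip A).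
  by case=> ? ? _ ? ?.
by apply: xgetPex; exact: ex_inv_sqrt_shifted_frame c0' AE.
Qed.

End Operators.

(** * Uniqueness of the truncated singular value decomposition *)

Section SingularValues.
Context (C : numClosedFieldType) (H : lmodType C) (ip : {dot H for @Num.conj C}).
Context (B : H -> H).

(** The predicate [svd] over an arbitrary closed field, with the singular values
    as elements of that field. *)
Definition is_svd m (s : 'I_m -> C) (p q : 'I_m -> H) : Prop :=
  [/\ forall i, 0 < s i, forall i j : 'I_m, (i <= j)%N -> s j <= s i,
      forall i j, ip (p i) (p j) = (i == j)%:R,
      forall i j, ip (q i) (q j) = (i == j)%:R &
      forall h, B h = \sum_i s i *: (ip h (q i) *: p i)].

Section OneSVD.
Context m (s : 'I_m -> C) (p q : 'I_m -> H).
Hypothesis Bsvd : is_svd s p q.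

Lemma svd_coefl h i : ip (B h) (p i) = s i * ip h (q i).
Proof.
have [_ _ pp _ BE] := Bsvd; rewrite BE linear_sumlz (bigD1 i) //= big1 => [|j ji].
  by rewrite !linearZl_LR /= pp eqxx mulr1 addr0.
by rewrite !linearZl_LR /= pp (negbTE ji) !mulr0.
Qed.

Lemma svd_map_right i : B (q i) = s i *: p i.
Proof.
have [_ _ _ qq BE] := Bsvd; rewrite BE (bigD1 i) //= big1 => [|j ji].
  by rewrite qq eqxx scale1r addr0.
by rewrite qq eq_sym (negbTE ji) scale0r scaler0.
Qed.

Lemma svd_range h : B h = \sum_i ip (B h) (p i) *: p i.
Proof.
have [_ _ _ _ BE] := Bsvd; rewrite [LHS]BE; apply: eq_bigr => i _.
by rewrite svd_coefl scalerA.
Qed.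

End OneSVD.

Section TwoSVD.
Context m (s : 'I_m -> C) (p q : 'I_m -> H).
Context m' (s' : 'I_m' -> C) (p' q' : 'I_m' -> H).
Hypotheses (Bsvd : is_svd s p q) (Bsvd' : is_svd s' p' q').

(** Left singular vectors lie in the range of [B], which the other family
    spans. *)
Lemma svd_left_expand i : p i = \sum_j ip (p i) (p' j) *: p' j.
Proof.
have [s0 _ _ _ _] := Bsvd; have si0 : s i != 0 by rewrite gt_eqF.
have -> : p i = (s i)^-1 *: B (q i).
  by rewrite (svd_map_right Bsvd) scalerA mulVf // scale1r.
rewrite {1}(svd_range Bsvd') scaler_sumr; apply: eq_bigr => j _.
by rewrite linearZl_LR scalerA.
Qed.

(** Both are eigenvectors of [B] composed with its adjoint, for the
    eigenvalues [s i ^+ 2] and [s' j ^+ 2]. *)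
Lemma svd_left_ortho i j : s i != s' j -> ip (p i) (p' j) = 0.
Proof.
move=> ss; have [s0 _ _ _ _] := Bsvd; have [s'0 _ _ _ _] := Bsvd'.
have e1 : s i * ip (p i) (p' j) = s' j * ip (q i) (q' j).
  by rewrite -(svd_coefl Bsvd') (svd_map_right Bsvd) linearZl_LR.
have e2 : s' j * ip (p i) (p' j) = s i * ip (q i) (q' j).
  rewrite ipC [in RHS]ipC -[X in X * _]geC0_conj ?ltW // -rmorphM /=.
  rewrite -[X in _ = X * _]geC0_conj ?ltW // -rmorphM /=; congr (_ ^_*).
  by rewrite -(svd_coefl Bsvd) (svd_map_right Bsvd') linearZl_LR.
have : (s i ^+ 2 - s' j ^+ 2) * ip (p i) (p' j) = 0.
  by rewrite mulrBl !expr2 -!mulrA e1 e2 mulrCA subrr.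
move/eqP; rewrite mulf_eq0 subr_eq0 eqrXn2 ?ltW // (negbTE ss) => /eqP; exact.
Qed.

End TwoSVD.

(** The matrix of inner products between the two left families is unitary and
    intertwines the two diagonal matrices of singular values; so these have the
    same characteristic polynomial, and sorting makes the lists equal. *)
Lemma svd_values_unique m (s : 'I_m -> C) p q m' (s' : 'I_m' -> C) p' q' :
  is_svd s p q -> is_svd s' p' q' ->
  m = m' /\ forall (i : 'I_m) (j : 'I_m'), i = j :> nat -> s i = s' j.
Proof.
move=> svd1 svd2; pose O := \matrix_(i, j) ip (p i) (p' j).
have OE i j : O i j = ip (p i) (p' j) by rewrite mxE.
have OO : O *m O^H = 1%:M.
  apply/matrixP => i k; rewrite !mxE; have [_ _ <- _ _] := svd1.
  rewrite [in RHS](svd_left_expand svd1 svd2 i) linear_sumlz; apply: eq_bigr => j _.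
  by rewrite linearZl_LR !mxE -ipC.
have O'O : O^H *m O = 1%:M.
  apply/matrixP => i k; rewrite !mxE; have [_ _ <- _ _] := svd2.
  rewrite [in RHS](svd_left_expand svd2 svd1 i) linear_sumlz; apply: eq_bigr => j _.
  by rewrite linearZl_LR !mxE -ipC.
have mm' : m = m'.
  by apply/eqP; rewrite eqn_leq (mulmx1_min OO) (mulmx1_min O'O).
case: m' / mm' s' p' q' svd2 O OE OO O'O => s' p' q' svd2 O OE OO O'O; split=> //.
have sO : diag_mx (\row_i s i) *m O = O *m diag_mx (\row_i s' i).
  rewrite mul_diag_mx mul_mx_diag; apply/matrixP => i j; rewrite !mxE mulrC OE.
  have [->//|/(svd_left_ortho svd1 svd2) ->] := eqVneq (s i) (s' j).
  by rewrite !mul0r.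
have : char_poly (diag_mx (\row_i s i)) = char_poly (diag_mx (\row_i s' i)).
  by rewrite -[in RHS](char_poly_similar _ O'O) -sO -mulmxA OO mulmx1.
have prodE (t : 'I_m -> C) : char_poly (diag_mx (\row_i t i)) =
    \prod_(z <- [seq t i | i : 'I_m]) ('X - z%:P).
  rewrite char_poly_diag big_map enumT; apply: eq_bigr => i _; by rewrite mxE.
rewrite !prodE => /prod_XsubC_eq ss.
have sorted_vals (t : 'I_m -> C) : (forall i j : 'I_m, (i <= j)%N -> t j <= t i) ->
    sorted (fun x y => y <= x) [seq t i | i : 'I_m].
  move=> tS; apply/(sortedP 0) => i; rewrite size_map size_enum_ord => im.
  rewrite !(nth_map (Ordinal im)) -?enumT ?size_enum_ord ?im ?(ltnW im) //.
  by apply: tS; rewrite !nth_enum_ord // ltnW.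
have /eq_in_map : [seq s i | i : 'I_m] = [seq s' i | i : 'I_m].
  apply: (@sorted_eq _ (fun x y => y <= x)) ss => //.
  - by move=> x y z /= yx zy; exact: le_trans zy yx.
  - by move=> x y /= /andP [yx xy]; apply/le_anti; rewrite yx xy.
  - by apply: sorted_vals; case: svd1.
  - by apply: sorted_vals; case: svd2.
by move=> ss' i j /val_inj <-; apply: ss'; rewrite mem_enum.
Qed.

(** Expand one projection in the other family. Inner products between a left
    vector before the cut and one after it vanish, as their singular values
    differ when there is no tie. *)
Lemma svd_truncation_unique r m (s : 'I_m -> C) p q m' (s' : 'I_m' -> C) p' q' :
  is_svd s p q -> is_svd s' p' q' ->
  ~ (exists i j : 'I_m, [/\ i.+1 = r, j = r :> nat & s i = s j]) ->
  forall h, \sum_(i < m | (i < r)%N) s i *: (ip h (q i) *: p i) =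
            \sum_(i < m' | (i < r)%N) s' i *: (ip h (q' i) *: p' i).
Proof.
move=> svd1 svd2 notie h.
have [mm' ss'] := svd_values_unique svd1 svd2.
have tie (i j : 'I_m) : (i < r)%N -> (r <= j)%N -> s i != s j.
  move=> ir rj; apply/eqP => sij; apply: notie; have [_ sS _ _ _] := svd1.
  have rm : (r < m)%N := leq_ltn_trans rj (ltn_ord j).
  have r1m : (r.-1 < m)%N := leq_ltn_trans (leq_pred r) rm.
  have r0 : r.-1.+1 = r by rewrite prednK // (leq_ltn_trans _ ir).
  exists (Ordinal r1m), (Ordinal rm); split=> //; apply/le_anti/andP; split.
    apply: (@le_trans _ _ (s i)); first by apply: sS; rewrite /= -ltnS r0.
    by rewrite sij; apply: sS.
  by apply: sS; rewrite /= leq_pred.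
have cross (i : 'I_m) (j : 'I_m') : (i < r)%N != (j < r)%N -> ip (p' j) (p i) = 0.
  move=> ir; apply: (svd_left_ortho svd2 svd1).
  rewrite -(ss' (cast_ord (esym mm') j) j) //.
  move: ir; have [ir|ir] := ltnP i r; have [jr|jr] := ltnP j r => // _.
    by rewrite eq_sym tie.
  by rewrite tie.
have truncE k (t : 'I_k -> C) u v : is_svd t u v ->
    \sum_(i < k | (i < r)%N) t i *: (ip h (v i) *: u i) =
    \sum_(i < k | (i < r)%N) ip (B h) (u i) *: u i.
  by move=> svdt; apply: eq_bigr => i _; rewrite (svd_coefl svdt) scalerA.
rewrite (truncE _ _ _ _ svd1) (truncE _ _ _ _ svd2).
transitivity (\sum_(i < m | (i < r)%N) \sum_(j < m' | (j < r)%N)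
    (ip (B h) (p' j) * ip (p' j) (p i)) *: p i).
  apply: eq_bigr => i ir; rewrite -scaler_suml; congr (_ *: _).
  rewrite {1}(svd_range svd2) linear_sumlz [RHS]big_mkcond /=; apply: eq_bigr => j _.
  rewrite linearZl_LR; case: ifPn => // jr.
  rewrite -[RHS](mulr0 (ip (B h) (p' j))); congr (_ * _); apply: cross.
  by rewrite ir (negbTE jr).
rewrite exchange_big /=; apply: eq_bigr => j jr.
rewrite [X in _ = _ *: X](svd_left_expand svd2 svd1 j) scaler_sumr [LHS]big_mkcond.
apply: eq_bigr => i _; rewrite scalerA; case: ifPn => // ir.
by rewrite cross ?mulr0 ?scale0r // jr (negbTE ir).
Qed.

End SingularValues.

(** * The generalized eigenvalue problem *)

(** [a = K^(1/2)], [b = (K + g)^(1/2)] and [b' = (K + g)^(-1/2)]; all three are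
    functions of [K], hence commute. *)
Lemma psd_square_roots (C : numClosedFieldType) n (K : 'M[C]_n) (g : C) :
  K^H = K -> (forall u : 'cV[C]_n, 0 <= (u^H *m K *m u) 0 0) -> 0 < g ->
  exists a b b' : 'M[C]_n,
    [/\ a^H = a /\ a *m a = K, b^H = b /\ b *m b = K + g%:M,
        b'^H = b' /\ b *m b' = 1%:M & a *m b = b *m a /\ a *m b' = b' *m a].
Proof.
move=> Kh Kp g0; have [P [d [PP KE]]] := hermitian_mxfun Kh.
have d0 : forall i, 0 <= d 0 i.
  by apply: (psd_spectrum_ge0 PP) => u; rewrite -KE.
have dg i : 0 < d 0 i + g by rewrite ltr_wpDl.
exists (mxfun P d sqrtC), (mxfun P d (fun t => sqrtC (t + g))).
exists (mxfun P d (fun t => (sqrtC (t + g))^-1)); split; split.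
- by apply: mxfun_ct => i; rewrite geC0_conj // sqrtC_ge0.
- by rewrite mxfunM // KE; apply: eq_mxfun => i; rewrite -expr2 sqrtCK.
- by apply: mxfun_ct => i; rewrite geC0_conj // sqrtC_ge0 ltW.
- rewrite mxfunM // KE -(mxfun_cst d PP) mxfunD; apply: eq_mxfun => i.
  by rewrite -expr2 sqrtCK.
- by apply: mxfun_ct => i; rewrite geC0_conj // invr_ge0 sqrtC_ge0 ltW.
- rewrite mxfunM // -(mxfun_cst d PP); apply: eq_mxfun => i.
  by rewrite divff // sqrtC_eq0 gt_eqF.
- by rewrite !mxfunM //; apply: eq_mxfun => i; rewrite mulrC.
- by rewrite !mxfunM //; apply: eq_mxfun => i; rewrite mulrC.
Qed.

(** The pencil [M - z Kg] and the matrix [Kg^(-1/2) M Kg^(-1/2)] have the same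
    eigenvalues with multiplicity. *)
Lemma char_poly_pencil (F : fieldType) n (M Kg b b' : 'M[F]_n) (q : {poly F}) :
  b *m b = Kg -> b *m b' = 1%:M ->
  \det ('X *: map_mx polyC Kg - map_mx polyC M) = (\det Kg)%:P * q ->
  char_poly (b' *m M *m b') = q.
Proof.
move=> bb bb' pencil; have b'b := mulmx1C bb'.
have dK : (\det Kg)%:P != 0 :> {poly F}.
  rewrite polyC_eq0 -bb det_mulmx.
  have : \det b * \det b' = 1 by rewrite -det_mulmx bb' det1.
  by apply: contra_eqN; rewrite mulf_eq0 orbb => /eqP ->; rewrite mul0r eq_sym oner_eq0.
apply: (mulfI dK); rewrite -pencil /char_poly /char_poly_mx.
rewrite -[in LHS]bb det_mulmx polyCM -!det_map_mx mulrAC -!det_mulmx; congr (\det _).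
rewrite mulmxBr mulmxBl mul_mx_scalar -scalemxAl -map_mxM bb; congr (_ - _).
by rewrite -!map_mxM -!mulmxA b'b mulmx1 !mulmxA bb' mul1mx.
Qed.

(** The columns of [U'] for nonzero [lam_j] are pencil eigenvectors, orthonormal
    for the form [K Kg], and equal to the columns of [U] where these exist; the
    others are set to zero so that the algebra stays with square matrices. The
    last property says that they span the range of [K T K] in the sense needed
    for the singular value decomposition to be complete. *)
Lemma pencil_eigenbasis (C : numClosedFieldType) n r (K T : 'M[C]_n) (g : C)
    (lam : seq C) (U : 'M[C]_(n, r)) :
  let Kg := K + g%:M in
  let M := T *m K *m T^H *m K in
  let D := diag_mx (\row_i lam`_i) in
  K^H = K -> (forall u : 'cV[C]_n, 0 <= (u^H *m K *m u) 0 0) -> 0 < g ->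
  (forall i, (lam`_i)^_* = lam`_i) ->
  \det ('X *: map_mx polyC Kg - map_mx polyC M) =
    (\det Kg)%:P * \prod_(t <- lam) ('X - t%:P) ->
  (r <= n)%N -> M *m U = Kg *m U *m diag_mx (\row_i lam`_i) ->
  U^H *m K *m Kg *m U = 1%:M ->
  exists U' : 'M[C]_n,
    [/\ size lam = n /\ forall i, (i < n)%N -> 0 <= lam`_i,
        U'^H *m K *m Kg *m U' = diag_mx (\row_i (lam`_i != 0)%:R) /\
        M *m U' = Kg *m U' *m D,
        forall (i : 'I_r) (j : 'I_n), i = j :> nat -> lam`_i != 0 ->
          col j U' = col i U,
        forall j : 'I_n, lam`_j = 0 -> col j U' = 0 &
        K *m (1%:M - Kg *m U' *m U'^H *m K) *m T *m K = 0].
Proof.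
move=> Kg M D Kh Kp g0 lamR pencil rn MU UU.
have [a [b [b' [[ah aa] [bh bb] [b'h bb'] [ab ab']]]]] := psd_square_roots Kh Kp g0.
rewrite -/Kg in bb; have b'b := mulmx1C bb'.
have [L LE] : exists L, L = a *m b' by exists (a *m b').
have Lh : L^H = L by rewrite LE ctmxM ah b'h -ab'.
have Lb : L *m b = a by rewrite LE -mulmxA b'b mulmx1.
have bL : b *m L = a by rewrite LE mulmxA -ab -mulmxA bb' mulmx1.
have LKg : L *m Kg = a *m b by rewrite -bb mulmxA Lb.
have Lab : L *m (a *m b) = K by rewrite ab mulmxA Lb.
have baL : b *m a *m L = K by rewrite -ab -mulmxA bL.
have Kgb' : Kg *m (b' *m b') = 1%:M.
  by rewrite -bb -!mulmxA [b *m (b' *m _)]mulmxA bb' mul1mx.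
have Kgb'C : b' *m b' *m Kg = 1%:M := mulmx1C Kgb'.
have [N NE] : exists N, N = T *m K *m T^H by exists (T *m K *m T^H).
have Nh : N^H = N by rewrite NE !ctmxM ctmxK Kh mulmxA.
have ME : M = N *m K by rewrite NE.
have [A AE] : exists A, A = L *m N *m L by exists (L *m N *m L).
have Ah : A^H = A by rewrite AE !ctmxM Lh Nh mulmxA.
have Alam : char_poly A = \prod_(t <- lam) ('X - t%:P).
  have <- : char_poly (b' *m (N *m K) *m b') = \prod_(t <- lam) ('X - t%:P).
    by apply: (char_poly_pencil bb bb'); rewrite -ME; exact: pencil.
  have -> : A = a *m (b' *m N *m (b' *m a)) by rewrite AE {1}LE LE ab' -ab' !mulmxA.
  have b'aa : b' *m a *m a = K *m b' by rewrite -ab' -mulmxA -ab' mulmxA aa.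
  by rewrite char_poly_mulC -[_ *m (b' *m a) *m a]mulmxA b'aa !mulmxA.
have [c cE] : exists c, c = a *m b *m U by exists (a *m b *m U).
have KKg : b *m a *m (a *m b) = K *m Kg.
  by rewrite -aa -bb !mulmxA -ab -[a *m b *m a]mulmxA -ab !mulmxA.
have cc : c^H *m c = 1%:M.
  rewrite cE !ctmxM ah bh -UU -!mulmxA; congr (_ *m _).
  by rewrite [K *m _]mulmxA -KKg !mulmxA.
have Ac : A *m c = c *m diag_mx (\row_i lam`_i).
  rewrite cE AE -!mulmxA [a *m (b *m U)]mulmxA [L *m (_ *m U)]mulmxA Lab.
  by rewrite [N *m _]mulmxA -ME MU !mulmxA LKg.
have nE : n = (r + (n - r))%N by rewrite subnKC.
have [W [WW AW cW]] := eigenbasis_extension nE lamR Ah Alam cc Ac.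
have WW' := mulmx1C WW.
(* Pseudo-inverse of the eigenvalue matrix, as [0^-1 = 0], and the projection
   on the nonzero eigenvalues. *)
pose Dp := diag_mx (\row_i (lam`_i)^-1) : 'M[C]_n.
pose E := diag_mx (\row_i (lam`_i != 0)%:R) : 'M[C]_n.
have DDp : D *m Dp = E.
  rewrite mulmx_diag; congr diag_mx; apply/rowP => i; rewrite !mxE.
  by have [->|l0] := eqVneq (lam`_i) 0; rewrite ?mul0r // divff.
have DpD : Dp *m D = E by rewrite diag_mxC.
have EE : E *m E = E.
  rewrite mulmx_diag; congr diag_mx; apply/rowP => i; rewrite !mxE.
  by case: (_ != _); rewrite ?mulr1 ?mulr0.
have Eh : E^H = E by apply: ctmx_diag => i; rewrite mxE rmorph_nat.
have DE : D *m (1%:M - E) = 0.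
  rewrite mulmxBr mulmx1 mulmx_diag -raddfB; apply/matrixP => i j; rewrite !mxE.
  by have [->|l0] := eqVneq (lam`_i) 0; rewrite ?mul0r ?mulr1 subrr mul0rn.
(* [A] is the Gram matrix of [a T^H L], hence nonnegative. *)
have Wgram : (a *m T^H *m L *m W)^H *m (a *m T^H *m L *m W) = D.
  rewrite !ctmxM ctmxK Lh ah !mulmxA -[_ *m a *m a]mulmxA aa.
  rewrite -[RHS]mul1mx -WW -[in RHS]mulmxA -AW AE NE !mulmxA //.
(* Solve [M u = lam Kg u] for [u], with [M u] expressed through the eigenvector
   [W_j = a b u] of [A]. *)
have [U' U'E] : exists U', U' = b' *m b' *m (N *m L *m W *m Dp) by eexists.
have KgU' : Kg *m U' = N *m L *m W *m Dp by rewrite U'E mulmxA Kgb' mul1mx.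
have abU' : a *m b *m U' = W *m E.
  by rewrite -LKg -mulmxA KgU' -DDp !mulmxA -AE AW.
have KU' : K *m U' = L *m W *m E by rewrite -Lab -mulmxA abU' mulmxA.
exists U'; split.
- split; first by have := size_char_poly A; rewrite Alam size_prod_XsubC => -[].
  by move=> i ni; have := ctmx_mul_diag_ge0 Wgram (Ordinal ni); rewrite mxE.
- split; last first.
    rewrite KgU' ME -mulmxA KU' !mulmxA NE.
    by rewrite -!mulmxA DpD.
  rewrite -[_ *m K *m Kg]mulmxA -KKg !mulmxA.
  rewrite -[U'^H *m b *m a]mulmxA -[_ *m a *m b]mulmxA.
  rewrite -[_ *m (a *m b) *m U']mulmxA abU'.
  have -> : U'^H *m (b *m a) = (W *m E)^H by rewrite -abU' !ctmxM ah bh.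
  by rewrite ctmxM Eh !mulmxA -[E *m _ *m W]mulmxA WW mulmx1 EE.
- have colU' j : col j U' = (lam`_j)^-1 *: (b' *m b' *m (N *m L *m col j W)).
    by rewrite U'E !mulmxA col_mul_diag mxE !colE !mulmxA.
  move=> i j ij lj; rewrite colU' (cW i j ij) cE.
  have -> : N *m L *m col i (a *m b *m U) = col i (M *m U).
    by rewrite ME !colE -!mulmxA [a *m (b *m _)]mulmxA [L *m (_ *m _)]mulmxA Lab.
  rewrite MU col_mul_diag mxE -scalemxAr scalerA -ij mulVf // scale1r.
  by rewrite !colE !mulmxA Kgb'C mul1mx.
- move=> j lj; rewrite U'E mulmxA col_mul_diag mxE lj invr0 scale0r //.
- have -> : K *m (1%:M - Kg *m U' *m U'^H *m K) = b *m a *m W *m (1%:M - E) *m W^H *m L.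
    have U'K : U'^H *m K = E *m W^H *m L.
      by rewrite -[LHS]ctmxK ctmxM ctmxK Kh KU' !ctmxM Lh Eh !mulmxA.
    have KKgU' : K *m Kg *m U' = b *m a *m W *m E by rewrite -KKg -mulmxA abU' !mulmxA.
    rewrite mulmxBr mulmx1 -[_ *m U'^H *m K]mulmxA U'K !mulmxA KKgU'.
    rewrite mulmxBr mulmx1 !mulmxBl -[b *m a *m W *m W^H]mulmxA WW' mulmx1 baL.
    by rewrite -[_ *m E *m E]mulmxA EE.
  (* Eigenvectors of [A] for the eigenvalue zero are killed by [a T^H L]. *)
  have Y0 : a *m T^H *m L *m W *m (1%:M - E) = 0.
    by apply: ctmx_mul_eq0; rewrite ctmxM -mulmxA [X in _ *m X]mulmxA Wgram DE mulmx0.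
  have {}Y0 : (1%:M - E) *m W^H *m L *m T *m a = 0.
    have := congr1 (fun Y => Y^H) Y0; rewrite !ctmxM ctmxB ctmx1 ctmxK Eh Lh ah.
    by rewrite trmx0 map_mx0 !mulmxA.
  transitivity (b *m a *m W *m ((1%:M - E) *m W^H *m L *m T *m a) *m a).
    by rewrite -[in LHS]aa !mulmxA.
  by rewrite Y0 mulmx0 mul0mx.
Qed.

(** * Spectrum of an operator that factors through a matrix *)

Section FactoredSpectrum.
Context (C : numClosedFieldType) (H : lmodType C) (r : nat).
Context (X : {linear 'cV[C]_r -> H}) (Y : {linear H -> 'cV[C]_r}) (N : 'M[C]_r).
Context (nu : 'I_r -> C) (wl wr : 'I_r -> 'cV[C]_r).
Hypothesis YX : forall v, Y (X v) = N *m v.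
Hypothesis Nwr : forall i, N *m wr i = nu i *: wr i.
Hypothesis wlN : forall i, (wl i)^H *m N = nu i *: (wl i)^H.
Hypothesis biortho : forall i j, (wl i)^H *m wr j = ((i == j)%:R)%:M.

Lemma biortho_expand (y : 'cV[C]_r) : y = \sum_i ((wl i)^H *m y) 0 0 *: wr i.
Proof.
pose Wr : 'M[C]_r := \matrix_(k, i) wr i k 0.
pose Wl : 'M[C]_r := \matrix_(k, i) wl i k 0.
have WW : Wl^H *m Wr = 1%:M.
  apply/matrixP => i j; have /matrixP/(_ 0 0) := biortho i j.
  by rewrite !mxE mulr1n => <-; apply: eq_bigr => k _; rewrite !mxE.
rewrite -[LHS]mul1mx -(mulmx1C WW) -mulmxA; apply/colP => k.
rewrite mxE summxE; apply: eq_bigr => i _; rewrite !mxE mulrC; congr (_ * _).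
by apply: eq_bigr => j _; rewrite !mxE.
Qed.

Lemma biortho_eq0 (y : 'cV[C]_r) : (forall i, ((wl i)^H *m y) 0 0 = 0) -> y = 0.
Proof.
by move=> wy; rewrite (biortho_expand y) big1 // => i _; rewrite wy scale0r.
Qed.

Lemma coef_shift z (y : 'cV[C]_r) i :
  ((wl i)^H *m (N *m y - z *: y)) 0 0 = (nu i - z) * ((wl i)^H *m y) 0 0.
Proof.
rewrite mulmxBr mulmxA wlN -scalemxAl -scalemxAr -scalerBl.
by rewrite [LHS]mxE.
Qed.

(** [Y] maps generalized eigenvectors of [X Y] to those of [Y X = N], which is
    diagonalizable; so [X Y] has no Jordan block for a nonzero eigenvalue. *)
Lemma factored_eigen_generalized z k h : z != 0 ->
  iter k (fun f => X (Y f) - z *: f) h = 0 -> X (Y h) = z *: h.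
Proof.
move=> z0; elim: k h => [|k IHk] h; first by move=> /= ->; rewrite !linear0 ?scaler0.
rewrite iterSr => /IHk; set h' := X (Y h) - z *: h => Gh'.
(* [h'] is already an eigenvector by induction; if [Y h'] vanishes so does
   [z *: h' = X (Y h')]. *)
suff h'0 : h' = 0 by apply/eqP; rewrite -subr_eq0 -/h' h'0.
have y'E : Y h' = N *m Y h - z *: Y h by rewrite linearB linearZ /= YX.
have Ny' : N *m Y h' - z *: Y h' = 0 by rewrite -YX Gh' linearZ /= subrr.
have y'0 : Y h' = 0.
  apply: biortho_eq0 => i; rewrite y'E coef_shift.
  have := coef_shift z (Y h') i; rewrite Ny' mulmx0 mxE y'E coef_shift.
  move/esym/eqP; rewrite mulf_eq0 => /orP [/eqP ->|/eqP //].
  by rewrite mul0r.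
by move: Gh'; rewrite y'0 linear0 => /esym/eqP; rewrite scaler_eq0 (negbTE z0) => /eqP.
Qed.

(** [X] is injective on the eigenvectors of [Y X] for a nonzero eigenvalue, and
    an eigenvector [h] of [X Y] is [z^-1 *: X (Y h)]. For [z = 0] this fails:
    the kernel of [X Y] has infinite dimension in general. *)
Lemma factored_alg_multiplicity z : z != 0 ->
  exists b : 'I_#|[set i | nu i == z]| -> H,
    (forall c : 'I_#|[set i | nu i == z]| -> C,
       \sum_i c i *: b i = 0 -> forall i, c i = 0) /\
    (forall h, (exists k, iter k (fun f => X (Y f) - z *: f) h = 0) <->
       (exists c : 'I_#|[set i | nu i == z]| -> C, h = \sum_i c i *: b i)).
Proof.
move=> z0; pose S := [set i | nu i == z]; pose e (i : 'I_#|S|) := enum_val i.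
have SE i : (i \in S) = (nu i == z).
  by apply/idP/idP => [/set_mem|/mem_set].
have nue i : nu (e i) = z by have := enum_valP i; rewrite SE => /eqP.
have XYe i : X (Y (X (wr (e i)))) = z *: X (wr (e i)).
  by rewrite YX Nwr nue linearZ.
exists (fun i => X (wr (e i))); split=> [c c0 j|h]; last split.
- have := congr1 (fun f => ((wl (e j))^H *m Y f) 0 0) c0.
  rewrite /= linear0 mulmx0 [RHS]mxE linear_sum mulmx_sumr summxE.
  rewrite (bigD1 j) //= big1 ?addr0 => [|i ij].
    rewrite linearZ /= YX Nwr nue -!scalemxAr biortho eqxx !mxE mulr1n mulr1.
    by move/eqP; rewrite mulf_eq0 (negbTE z0) orbF => /eqP.
  rewrite linearZ /= YX Nwr nue -!scalemxAr biortho.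
  by rewrite (inj_eq enum_val_inj) eq_sym (negbTE ij) !mxE mul0rn !mulr0.
- move=> [k /(factored_eigen_generalized z0) Gh].
  exists (fun i => z^-1 * ((wl (e i))^H *m Y h) 0 0).
  have hE : h = z^-1 *: X (Y h) by rewrite Gh scalerA mulVf // scale1r.
  have Ny : N *m Y h - z *: Y h = 0 by rewrite -YX Gh linearZ /= subrr.
  rewrite [LHS]hE {1}(biortho_expand (Y h)) linear_sum scaler_sumr /=.
  transitivity (\sum_(i in S) (z^-1 * ((wl i)^H *m Y h) 0 0) *: X (wr i)).
    rewrite [RHS]big_mkcond /=; apply: eq_bigr => i _; rewrite linearZ /= scalerA SE.
    case: eqP => // /eqP nuz; have := coef_shift z (Y h) i.
    rewrite Ny mulmx0 mxE => /esym/eqP; rewrite mulf_eq0 subr_eq0 (negbTE nuz).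
    by move=> /eqP ->; rewrite mulr0 scale0r.
  by rewrite big_enum_val.
- move=> [c ->]; exists 1%N => /=; apply/eqP; rewrite subr_eq0; apply/eqP.
  rewrite (linear_sum Y) (linear_sum X) scaler_sumr; apply: eq_bigr => i _ /=.
  by rewrite !linearZ /= XYe !scalerA mulrC.
Qed.

End FactoredSpectrum.

(** * The whitened operator and its truncation *)

Section WhitenedOperator.
Context (C : numClosedFieldType) (H : lmodType C) (ip : {dot H for @Num.conj C}).
Context (n : nat) (psi : 'I_n -> H) (T : 'M[C]_n) (g : C) (Q : H -> H).
Local Notation Z := (synthesis psi).
Local Notation Zs := (analysis ip psi).
Local Notation K := (frame_gram ip psi).
Local Notation Kg := (K + g%:M).
Hypothesis Ql : linear Q.
Hypothesis Qsa : forall f h, ip (Q f) h = ip f (Q h).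
Hypothesis QQA : forall h, Q (Q (g *: h + Z (Zs h))) = h.
Hypothesis AQQ : forall h, g *: Q (Q h) + Z (Zs (Q (Q h))) = h.

Lemma shifted_synthesis v : g *: Z v + Z (Zs (Z v)) = Z (Kg *m v).
Proof.
by rewrite analysis_synthesis mulmxDl mul_scalar_mx synthesisD synthesisZ addrC.
Qed.

(** The square root of [Z Zs + g] applied to [Z v]: the left singular vector
    attached to the coefficients [v]. *)
Definition whiten v := Q (Z (Kg *m v)).

Lemma inv_sqrt_whiten v : Q (whiten v) = Z v.
Proof. by rewrite /whiten -shifted_synthesis QQA. Qed.

Lemma inv_sqrt_inj : injective Q.
Proof. by move=> f h fh; rewrite -[f]AQQ fh AQQ. Qed.

Lemma ip_whiten u v : ip (whiten u) (whiten v) = (v^H *m K *m Kg *m u) 0 0.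
Proof.
rewrite {1}/whiten Qsa inv_sqrt_whiten ip_synthesisr analysis_synthesis.
by rewrite !mulmxA.
Qed.

Definition whitened_op h := Q (Z (T *m Zs h)).

Lemma ip_whitened_op h v :
  ip (whitened_op h) (whiten v) = (v^H *m K *m T *m Zs h) 0 0.
Proof.
rewrite /whitened_op Qsa inv_sqrt_whiten ip_synthesisr analysis_synthesis.
by rewrite !mulmxA.
Qed.

(** The range of [Zs] is that of [K]; here through adjoints, [Z N^H = 0]. *)
Lemma analysis_eq0 m (N : 'M[C]_(m, n)) : N *m K = 0 -> forall h, N *m Zs h = 0.
Proof.
move=> NK h; apply/colP => i.
have ZN : Z (row i N)^H = 0.
  apply: (@synthesis_eq0 _ _ ip).
  rewrite -[LHS]ctmxK ctmxM ctmxK frame_gram_herm -row_mul NK.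
  by apply/matrixP => ? ?; rewrite !mxE conjC0.
by have := ip_synthesisr ip psi h (row i N)^H; rewrite ZN linear0r ctmxK -row_mul !mxE.
Qed.

Fact whiten_linear : linear whiten.
Proof. by move=> a u v; rewrite /whiten -Ql linearP linearP. Qed.

(** [whiten u_i] are orthonormal by the Gram form, [q_i] is the adjoint of [B]
    applied to [whiten u_i] and divided by [s_i], and the completeness of [U]
    makes the sum equal to [B]. *)
Lemma whitened_op_svd (lam : seq C) (U : 'M[C]_n) m (mn : (m <= n)%N) (s : 'I_m -> C) :
  U^H *m K *m Kg *m U = diag_mx (\row_i (lam`_i != 0)%:R) ->
  T *m K *m T^H *m K *m U = Kg *m U *m diag_mx (\row_i lam`_i) ->
  (forall j : 'I_n, (m <= j)%N -> col j U = 0) ->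
  K *m (1%:M - Kg *m U *m U^H *m K) *m T *m K = 0 ->
  (forall i, 0 < s i) -> (forall i, s i ^+ 2 = lam`_i) ->
  (forall i j : 'I_m, (i <= j)%N -> s j <= s i) ->
  is_svd ip whitened_op s (fun i => whiten (col (widen_ord mn i) U))
    (fun i => (s i)^-1 *: Z (T^H *m K *m col (widen_ord mn i) U)).
Proof.
move=> UU MU U0 UK s0 sE sS; pose u i := col (widen_ord mn i) U.
have uu i j : ((u j)^H *m K *m Kg *m u i) 0 0 = (i == j)%:R.
  have lam0 : lam`_j != 0 by rewrite -sE expf_neq0 // gt_eqF.
  have /matrixP/(_ (widen_ord mn j) (widen_ord mn i)) := UU.
  rewrite [RHS]mxE [X in X *+ _]mxE /= lam0 eq_sym.
  have -> : (widen_ord mn i == widen_ord mn j) = (i == j) by [].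
  by move=> <-; rewrite -!(mulmxA _ K Kg) ctm_col_entry.
have Mu i : T *m K *m T^H *m K *m u i = lam`_i *: (Kg *m u i).
  have := congr1 (col (widen_ord mn i)) MU.
  by rewrite col_mul_diag mxE /u !colE !mulmxA.
have ipq i h : ip h ((s i)^-1 *: Z (T^H *m K *m u i)) =
    (s i)^-1 * ((u i)^H *m K *m T *m Zs h) 0 0.
  rewrite linearZr_LR /= ip_synthesisr !ctmxM ctmxK frame_gram_herm geC0_conj ?mulmxA //.
  by rewrite invr_ge0 ltW.
split=> // [i j|i j|h].
- by rewrite ip_whiten uu.
- rewrite -/(u i) -/(u j) linearZl_LR /= ipq analysis_synthesis.
  have -> : (u j)^H *m K *m T *m (K *m (T^H *m K *m u i)) =
      lam`_i *: ((u j)^H *m K *m Kg *m u i).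
    by rewrite -[_ *m Kg *m u i]mulmxA scalemxAr -Mu !mulmxA.
  rewrite mxE uu; have [->|_] := eqVneq i j; last by rewrite !mulr0.
  by rewrite mulr1 -sE expr2 mulKf ?mulVf ?gt_eqF.
- rewrite -[RHS]/(\sum_i s i *: (ip h _ *: whiten (u i))).
  transitivity (whiten (U *m (U^H *m K *m T *m Zs h))).
    rewrite /whitened_op /whiten; congr (Q _).
    apply/eqP; rewrite -subr_eq0 -linearB; apply/eqP/(@synthesis_eq0 _ _ ip).
    have := analysis_eq0 UK h; rewrite mulmxBr mulmx1 !mulmxBl => <-.
    by rewrite mulmxBr !mulmxA.
  rewrite mul_ctm_sum.
  pose wL : {linear 'cV[C]_n -> H} :=
    HB.pack whiten (GRing.isLinear.Build _ _ _ _ whiten whiten_linear).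
  have wZ a v : whiten (a *: v) = a *: whiten v by exact: (linearZ_LR wL).
  have w0 : whiten 0 = 0 by exact: (linear0 wL).
  rewrite -[whiten]/(wL : _ -> _) linear_sum /=.
  rewrite (bigID (fun j : 'I_n => (j < m)%N)) /= [X in _ + X]big1 ?addr0; last first.
    by move=> j; rewrite -leqNgt => mj; rewrite U0 // scaler0 w0.
  rewrite (big_ord_narrow mn); apply: eq_bigr => i _.
  by rewrite wZ -/(u i) ipq scalerA mulVKf // gt_eqF.
Qed.

(** The list [lam] is nonincreasing and nonnegative, so its nonzero entries come
    first and their number is the rank of the operator. *)
Lemma whitened_op_leading_svd r (lam : seq C) (U : 'M[C]_(n, r)) : 0 < g ->
  (forall i, (lam`_i)^_* = lam`_i) -> sorted (fun y z => z <= y) lam ->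
  \det ('X *: map_mx polyC Kg - map_mx polyC (T *m K *m T^H *m K)) =
    (\det Kg)%:P * \prod_(t <- lam) ('X - t%:P) ->
  (r <= n)%N ->
  T *m K *m T^H *m K *m U = Kg *m U *m diag_mx (\row_i lam`_i) ->
  U^H *m K *m Kg *m U = 1%:M ->
  exists m (p q : 'I_m -> H),
    [/\ is_svd ip whitened_op (fun i => sqrtC lam`_i) p q,
        forall i : 'I_m, 0 <= lam`_i &
        forall (i : 'I_m) (j : 'I_r), i = j :> nat -> Q (p i) = Z (col j U)].
Proof.
move=> g0 lamR lamS pencil rn MU UU.
have [U' [[slam lam0] [U'U' MU'] U'U U'0 U'K]] :=
  pencil_eigenbasis (frame_gram_herm ip psi) (frame_gram_psd ip psi) g0 lamR
    pencil rn MU UU.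
have lam_le i j : (i <= j)%N -> (j < n)%N -> lam`_j <= lam`_i.
  move=> ij jn; apply: (sorted_leq_nth _ _ _ lamS) => //.
  - by move=> x y z /= yx zy; exact: le_trans zy yx.
  - by rewrite inE slam (leq_ltn_trans ij).
  - by rewrite inE slam.
pose m := find (pred1 0) lam.
have mn : (m <= n)%N by rewrite -slam find_size.
have lam_gt0 i : (i < m)%N -> 0 < lam`_i.
  move=> im; rewrite lt_neqAle eq_sym lam0 ?(leq_trans im) // andbT.
  by have /= -> := before_find 0 im.
have lam_eq0 i : (m <= i)%N -> (i < n)%N -> lam`_i = 0.
  move=> mi i_n; apply/le_anti; rewrite lam0 // andbT.
  have hm : has (pred1 0) lam by rewrite has_find slam (leq_ltn_trans mi).
  have /eqP lamm := nth_find 0 hm.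
  by apply: le_trans (lam_le m i mi i_n) _; rewrite lamm.
exists m; do 2![eexists]; split; first apply: (@whitened_op_svd lam U' m mn).
- exact: U'U'.
- exact: MU'.
- by move=> j mj; apply: U'0; apply: lam_eq0.
- exact: U'K.
- by move=> i; rewrite sqrtC_gt0 lam_gt0.
- by move=> i; rewrite sqrtCK.
- move=> i j ij; rewrite ler_sqrtC ?nnegrE ?(ltW (lam_gt0 _ _)) ?lam_le //.
  exact: leq_trans (ltn_ord j) mn.
- by move=> i; apply/ltW/lam_gt0.
- move=> i j ij; rewrite inv_sqrt_whiten (U'U j (widen_ord mn i)) //.
  by rewrite -ij gt_eqF // lam_gt0.
Qed.

Lemma ip_whiten_col r (U : 'M[C]_(n, r)) i j : U^H *m K *m Kg *m U = 1%:M ->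
  ip (whiten (col i U)) (whiten (col j U)) = (i == j)%:R.
Proof.
move=> UU; rewrite ip_whiten -(mulmxA _ K Kg) ctm_col_entry mulmxA UU mxE.
by rewrite eq_sym.
Qed.

(** The truncation is the projection of [B h] on the leading left vectors. When
    the rank [m] is less than [r], the surplus columns of [U] do not contribute:
    [whiten] of them is orthogonal to the range of [B]. *)
Lemma whitened_op_truncation r (U : 'M[C]_(n, r)) m (s : 'I_m -> C) p q :
  U^H *m K *m Kg *m U = 1%:M -> is_svd ip whitened_op s p q ->
  (forall (i : 'I_m) (j : 'I_r), i = j :> nat -> Q (p i) = Z (col j U)) ->
  forall h, Q (\sum_(i < m | (i < r)%N) s i *: (ip h (q i) *: p i)) =
            Z (U *m (U^H *m K *m T *m Zs h)).
Proof.
move=> UU Bsvd pU h.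
pose QL : {linear H -> H} := HB.pack Q (GRing.isLinear.Build _ _ _ _ Q Ql).
have pE (i : 'I_m) (j : 'I_r) : i = j :> nat -> p i = whiten (col j U).
  by move=> ij; apply: inv_sqrt_inj; rewrite inv_sqrt_whiten (pU i j).
pose f (j : 'I_r) := ip (whitened_op h) (whiten (col j U)) *: Z (col j U).
(* Both sums are over initial segments of the naturals: extend the summand by
   zero beyond [r]; it then also vanishes beyond [m]. *)
pose F (k : nat) := oapp f 0 (insub k : option 'I_r).
have F0 k : (r <= k)%N -> F k = 0.
  by rewrite leqNgt => rk; rewrite /F insubN.
have Fj (j : 'I_r) : F j = f j by rewrite /F valK.
have F0m k : (m <= k)%N -> F k = 0.
  move=> mk; have [kr|/F0//] := ltnP k r.
  rewrite -[k]/(val (Ordinal kr)) Fj /f (svd_range Bsvd) linear_sumlz big1 ?scale0r //.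
  move=> i _; rewrite linearZl_LR /=.
  have ir : (i < r)%N := ltn_trans (leq_trans (ltn_ord i) mk) kr.
  rewrite (pE i (Ordinal ir)) // ip_whiten_col // -val_eqE /=.
  by rewrite (ltn_eqF (leq_trans (ltn_ord i) mk)) mulr0.
have addF a b : (forall k, (a <= k)%N -> F k = 0) ->
    \sum_(i < a + b) F i = \sum_(i < a) F i.
  move=> Fa; rewrite big_split_ord /= [X in _ + X]big1 ?addr0 // => i _.
  by rewrite Fa // leq_addr.
transitivity (\sum_(i < m) F i).
  rewrite -[Q _]/(QL _) linear_sum /= big_mkcond; apply: eq_bigr => i _ /=.
  case: ifPn => [ir|]; last by rewrite -leqNgt => /F0.
  rewrite -[F i]/(F (Ordinal ir)) Fj /f scalerA -(svd_coefl Bsvd).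
  by rewrite -[Q _]/(QL _) linearZ /= (pE i (Ordinal ir)) // inv_sqrt_whiten.
rewrite -(addF _ r F0m) addnC (addF _ m F0).
rewrite mul_ctm_sum.
rewrite linear_sum; apply: eq_bigr => j _.
by rewrite Fj /f ip_whitened_op /= synthesisZ.
Qed.

(** The adjoint of [Z U U^H K T Zs] is [Z (T^H K U) (U^H Zs)]. *)
Lemma compression_adjoint r (U : 'M[C]_(n, r)) h f :
  ip (Z (U *m (U^H *m K *m T *m Zs h))) f =
  ip h (Z (T^H *m K *m U *m (U^H *m Zs f))).
Proof.
rewrite ip_synthesisl ip_synthesisr !ctmxM !ctmxK frame_gram_herm.
by rewrite !mulmxA.
Qed.

Lemma compression_right r (U : 'M[C]_(n, r)) nu w :
  (K *m U)^H *m T *m (K *m U) *m w = nu *: w ->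
  Z (U *m (U^H *m K *m T *m Zs (Z (U *m w)))) = nu *: Z (U *m w).
Proof.
rewrite ctmxM frame_gram_herm => Nw; rewrite analysis_synthesis.
have -> : U^H *m K *m T *m (K *m (U *m w)) = nu *: w by rewrite -Nw !mulmxA.
by rewrite -scalemxAr synthesisZ.
Qed.

Lemma compression_left r (U : 'M[C]_(n, r)) nu w :
  w^H *m ((K *m U)^H *m T *m (K *m U)) = nu *: w^H ->
  Z (T^H *m K *m U *m (U^H *m Zs (Z (T^H *m K *m U *m w)))) =
    nu^_* *: Z (T^H *m K *m U *m w).
Proof.
move=> wN; have := congr1 (fun y => y^H) wN.
rewrite ctmxZ ctmxK !ctmxM !ctmxK frame_gram_herm => Nw.
rewrite analysis_synthesis -synthesisZ scalemxAr -Nw !mulmxA //.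
Qed.

Lemma compression_alg_multiplicity r (U : 'M[C]_(n, r)) (nu : 'I_r -> C)
    (wl wr : 'I_r -> 'cV[C]_r) z :
  (forall i, (K *m U)^H *m T *m (K *m U) *m wr i = nu i *: wr i) ->
  (forall i, (wl i)^H *m ((K *m U)^H *m T *m (K *m U)) = nu i *: (wl i)^H) ->
  (forall i j, (wl i)^H *m wr j = ((i == j)%:R)%:M) -> z != 0 ->
  exists b : 'I_#|[set i | nu i == z]| -> H,
    (forall c : 'I_#|[set i | nu i == z]| -> C,
       \sum_i c i *: b i = 0 -> forall i, c i = 0) /\
    (forall h, (exists k, iter k (fun f =>
         Z (U *m (U^H *m K *m T *m Zs f)) - z *: f) h = 0) <->
       (exists c : 'I_#|[set i | nu i == z]| -> C, h = \sum_i c i *: b i)).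
Proof.
move=> Nwr wlN bio z0.
pose X v := Z (U *m v); pose Y h := U^H *m K *m T *m Zs h.
have Xl : linear X by move=> a u v; rewrite /X mulmxDr -scalemxAr synthesisD synthesisZ.
have Yl : linear Y by move=> a u v; rewrite /Y analysisD analysisZ mulmxDr -scalemxAr.
pose XL : {linear 'cV[C]_r -> H} := HB.pack X (GRing.isLinear.Build _ _ _ _ X Xl).
pose YL : {linear H -> 'cV[C]_r} := HB.pack Y (GRing.isLinear.Build _ _ _ _ Y Yl).
apply: (@factored_alg_multiplicity C H r XL YL _ nu wl wr _ Nwr wlN bio z z0).
by move=> v; rewrite /= /Y /X analysis_synthesis ctmxM frame_gram_herm !mulmxA.
Qed.

End WhitenedOperator.

(** * Adjoints of Toeplitz operators and matrices *)

Section ComplexIntegral.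
Context (R : realType) (d : measure_display) (T : measurableType d).
Context (mu : {measure set T -> \bar R}).
Implicit Types (f g : T -> R[i]).

(** No integrability is required: if both the positive and the negative part
    have infinite integral, the real-valued integral is zero on both sides. *)
Lemma Rintegral_opp (f : T -> R) :
  (\int[mu]_x (- f x) = - \int[mu]_x f x)%R.
Proof.
rewrite /Rintegral; under eq_integral do rewrite EFinN.
rewrite integralE [in RHS]integralE.
rewrite (_ : (fun x => - (f x)%:E)%E = (\- (fun x => (f x)%:E))%E) //.
rewrite funeposN funenegN.
case: (integral _ _ _) => [u| |]; case: (integral _ _ _) => [v| |] //=; rewrite ?oppr0 //.
by rewrite opprB.
Qed.

Lemma cintegral_conj f : cintegral mu (fun x => (f x)^_*) = (cintegral mu f)^_*.
Proof.
rewrite /cintegral /=; congr (_ +i* _).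
  by congr Rintegral; apply/funext => x; case: (f x).
by rewrite -Rintegral_opp; congr Rintegral; apply/funext => x; case: (f x).
Qed.

Lemma cintegral_opp f : cintegral mu (fun x => - f x) = - cintegral mu f.
Proof.
rewrite /cintegral -[RHS]/(_ +i* _); congr (_ +i* _); rewrite -Rintegral_opp.
  by congr Rintegral; apply/funext => x; case: (f x).
by congr Rintegral; apply/funext => x; case: (f x).
Qed.

Lemma l2_ipC f g : l2_ip mu f g = (l2_ip mu g f)^_*.
Proof.
rewrite /l2_ip -cintegral_conj; congr cintegral; apply/funext => x.
by rewrite rmorphM /= conjCK mulrC.
Qed.

Lemma l2_ipNl f g : l2_ip mu (fun x => - f x) g = - l2_ip mu f g.
Proof.
by rewrite /l2_ip -cintegral_opp; congr cintegral; apply/funext => x; rewrite mulNr.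
Qed.

Lemma l2_adjoint_iter (A B : (T -> R[i]) -> T -> R[i]) j f g : l2_adjoint mu A B ->
  in_L2 mu f -> in_L2 mu g -> l2_ip mu (iter j A f) g = l2_ip mu f (iter j B g).
Proof.
move=> [A2 B2 AB]; elim: j f g => [//|j IHj] f g f2 g2.
rewrite iterS AB //; last first.
  by elim: j {IHj} => [//|j IHj]; rewrite iterS; apply: A2.
by rewrite IHj ?iterSr //; exact: B2.
Qed.

End ComplexIntegral.

Section AdjointSymbol.
Context (R : realType) (d : measure_display) (T : measurableType d).
Context (pi : probability T R) (A As : (T -> R[i]) -> T -> R[i]).
Hypothesis AAs : l2_adjoint pi A As.

Lemma complex_cvg_conj (u : nat -> R[i]) l : complex_cvg u l ->
  complex_cvg (fun N => (u N)^_*) l^_*.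
Proof.
move=> [ur ui]; split.
  rewrite (_ : (fun N => _) = (fun N => complex.Re (u N))); last first.
    by apply/funext => N; case: (u N).
  by rewrite (_ : complex.Re _ = complex.Re l) //; case: l {ur ui}.
rewrite (_ : (fun N => _) = (fun N => - complex.Im (u N))); last first.
  by apply/funext => N; case: (u N).
by rewrite (_ : complex.Im l^_* = - complex.Im l); [exact: cvgN|case: l {ur ui}].
Qed.

Lemma complex_cvg_opp (u : nat -> R[i]) l : complex_cvg u l ->
  complex_cvg (fun N => - u N) (- l).
Proof.
move=> [ur ui]; split.
  rewrite (_ : (fun N => _) = (fun N => - complex.Re (u N))); last first.
    by apply/funext => N; case: (u N).
  by rewrite (_ : complex.Re (- l) = - complex.Re l); [exact: cvgN|case: l {ur ui}].
rewrite (_ : (fun N => _) = (fun N => - complex.Im (u N))); last first.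
  by apply/funext => N; case: (u N).
by rewrite (_ : complex.Im (- l) = - complex.Im l); [exact: cvgN|case: l {ur ui}].
Qed.

(** Conjugating the weak limit exchanges the powers of [A] and of [As], and
    conjugates the coefficients. *)
Lemma toeplitz_operator_adjoint a F G : toeplitz_operator pi A As a F ->
  l2_adjoint pi F G -> toeplitz_operator pi A As (adjoint_symbol a) G.
Proof.
move=> [_ Fa] [_ G2 FG]; split=> [//|f g f2 g2].
rewrite [l2_ip pi (G f) g]l2_ipC -FG //; have := complex_cvg_conj (Fa g f g2 f2).
rewrite /adjoint_symbol; congr complex_cvg; apply/funext => N.
have AsA : l2_adjoint pi As A.
  have [A2 As2 AB] := AAs; split=> // u v u2 v2.
  by rewrite l2_ipC -AB // -l2_ipC.
rewrite rmorphD rmorphM /= -l2_ipC oppr0 rmorph_sum; congr (_ + _).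
apply: eq_bigr => j _; rewrite rmorphD !rmorphM /= opprK addrC.
congr (_ * _ + _ * _).
  by rewrite (l2_adjoint_iter _ AsA) // -l2_ipC.
by rewrite (l2_adjoint_iter _ AAs) // -l2_ipC.
Qed.

Lemma toeplitz_operator_opp a F : (forall f, in_L2 pi f -> in_L2 pi (F f)) ->
  toeplitz_operator pi A As a (fun f x => - F f x) ->
  toeplitz_operator pi A As (fun j => - a j) F.
Proof.
move=> F2 [_ Fa]; split=> // f g f2 g2.
have := complex_cvg_opp (Fa f g f2 g2); rewrite l2_ipNl opprK.
congr complex_cvg; apply/funext => N; rewrite opprD mulNr -sumrN; congr (_ + _).
by apply: eq_bigr => j _; rewrite opprD !mulNr.
Qed.

Lemma separated_selfadjoint_symbol l a F : toeplitz_operator pi A As a F ->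
  l2_selfadjoint pi F -> symbols_separated pi A As l a (adjoint_symbol a) ->
  forall j : int, (`|j| <= l)%N -> a j = adjoint_symbol a j.
Proof. by move=> Fa Fsa; apply; last exact: toeplitz_operator_adjoint Fa Fsa. Qed.

(** [- F] has the adjoint symbol, hence [F] has its opposite. *)
Lemma separated_skewadjoint_symbol l a F : toeplitz_operator pi A As a F ->
  l2_skewadjoint pi F ->
  symbols_separated pi A As l a (fun j => - adjoint_symbol a j) ->
  forall j : int, (`|j| <= l)%N -> a j = - adjoint_symbol a j.
Proof.
move=> Fa Fsk; apply; first exact: Fa.
apply: toeplitz_operator_opp; last exact: toeplitz_operator_adjoint Fa Fsk.
by case: Fa.
Qed.

End AdjointSymbol.

(** The weights [n / (n - |j|)] are even in [j], so only the coefficients decide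
    the symmetry. *)
Lemma toeplitz_mx_adjoint (R : realType) n l (a : int -> R[i]) (e : R[i]) :
  (forall j : int, (`|j| <= l)%N -> adjoint_symbol a j = e * a j) ->
  (toeplitz_mx n l a)^H = e *: toeplitz_mx n l a.
Proof.
move=> ae; apply/matrixP => i k; rewrite !mxE /=.
rewrite -[(i%:Z - k%:Z)%R]opprB abszN; case: leqP => jl; last by rewrite conjC0 mulr0.
rewrite !rmorphM fmorphV /= !rmorph_nat -/(adjoint_symbol a _) ae //.
by rewrite !mulrA [e * _]mulrC.
Qed.

(** * Centered features and the empirical operators *)

Section CenteredFeatures.
Context (R : realType) (H : lmodType R[i]) (ip : {dot H for @Num.conj R[i]}).
Context (T : Type) (phi : T -> H) (n : nat) (x : 'I_n -> T).
Hypothesis n_gt0 : (0 < n)%N.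
Local Notation C := R[i].
Local Notation c := (((Num.sqrt n%:R)^-1)%:C : C).

Definition centered_feature (i : 'I_n) : H := c *: (phi (x i) - feature_mean phi x).
Local Notation psi := centered_feature.

Lemma sqrt_weight : c * c = n%:R^-1.
Proof.
rewrite -rmorphM /= -invfM -expr2 sqr_sqrtr ?ler0n // fmorphV /=.
by rewrite rmorph_nat.
Qed.

Lemma weight_conj : c^_* = c.
Proof. exact: conjc_real. Qed.

Lemma centeringE i j : (Complexify (centering R n)) i j = (i == j)%:R - n%:R^-1 :> C.
Proof. by rewrite !mxE rmorphB /= fmorphV /= !rmorph_nat. Qed.

Lemma centered_sum (f : 'I_n -> H) i :
  \sum_j (Complexify (centering R n)) i j *: f j = f i - n%:R^-1 *: \sum_j f j.
Proof.
under eq_bigr do rewrite centeringE scalerBl.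
rewrite sumrB scaler_sumr; congr (_ - _).
rewrite (bigD1 i) //= big1 => [|j ji]; first by rewrite eqxx scale1r addr0.
by rewrite eq_sym (negbTE ji) scale0r.
Qed.

Lemma centering_sym i j :
  (Complexify (centering R n)) i j = (Complexify (centering R n)) j i :> C.
Proof. by rewrite !centeringE eq_sym. Qed.

(** The centering matrix is symmetric, so it can be moved from the coefficients
    to the features, where it subtracts the mean. *)
Lemma sampling_adj_centering (v : 'cV[C]_n) :
  sampling_adj phi x (Complexify (centering R n) *m v) = synthesis psi v.
Proof.
rewrite /sampling_adj /synthesis.
transitivity (c *: \sum_i \sum_j (v j 0 * Complexify (centering R n) j i) *: phi (x i)).
  congr (_ *: _); apply: eq_bigr => i _; rewrite mxE scaler_suml.
  by apply: eq_bigr => j _; rewrite centering_sym mulrC.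
rewrite exchange_big /= scaler_sumr; apply: eq_bigr => j _.
rewrite /centered_feature /feature_mean -centered_sum scalerA mulrC -scalerA.
congr (_ *: _); rewrite scaler_sumr; apply: eq_bigr => i _; by rewrite scalerA.
Qed.

Lemma centered_gram (k : T -> T -> R) :
  (forall y z, (k y z)%:C = ip (phi y) (phi z)) ->
  Complexify (cgram x k) = frame_gram ip psi.
Proof.
move=> kE.
have kC y z : ip (phi y) (phi z) = (k z y)%:C.
  by rewrite ipC -kE; exact: conjc_real.
apply/matrixP => i j; rewrite [RHS]mxE /centered_feature.
rewrite linearZl_LR linearZr_LR /= weight_conj mulrA sqrt_weight.
rewrite /feature_mean -!(centered_sum (fun i => phi (x i))) linear_sumr.
rewrite /cgram map_mxZ !map_mxM mxE fmorphV rmorph_nat; congr (_ * _).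
rewrite -mulmxA mxE; apply: eq_bigr => l _.
rewrite linearZr_LR /= mxE linear_sumlz; congr (_ * _).
  by rewrite !mxE; exact/esym/conjc_real.
rewrite mxE; apply: eq_bigr => m _; rewrite linearZl_LR /= mulrC centering_sym.
congr (_ * _).
by rewrite !mxE kC.
Qed.

(** The [j]-th diagonal, with the weight that turns [1/n], the normalization
    of [Z Zs], into the normalization [1/(n-j)] of the lagged covariance. *)
Definition lag_mx (j : nat) : 'M[C]_n :=
  \matrix_(i, i') if (i' == i + j :> nat)%N then n%:R / (n - j)%:R else 0.

Lemma cov_lag j h : (j < n)%N -> cov ip phi x j h =
  synthesis psi (lag_mx j *m analysis ip psi h).
Proof.
move=> jn; have nj0 : (n - j)%:R != 0 :> C by rewrite pnatr_eq0 subn_eq0 -ltnNge.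
have n0 : n%:R != 0 :> C by rewrite pnatr_eq0 -lt0n.
rewrite /cov /synthesis scaler_sumr; apply: eq_bigr => i _.
rewrite mxE scaler_suml scaler_sumr big_mkcond; apply: eq_bigr => i' _ /=.
rewrite !mxE; case: eqP => // _; last by rewrite mul0r scale0r.
rewrite /tens /centered_feature linearZr_LR /= weight_conj !scalerA; congr (_ *: _).
set u := ip h _.
transitivity (n%:R / (n - j)%:R * (c * c) * u); last by ring.
by rewrite sqrt_weight; field; rewrite nj0 n0.
Qed.

Lemma cov_lag_adjoint j : (j < n)%N -> adjoint ip (cov ip phi x j) =
  fun h => synthesis psi ((lag_mx j)^T *m analysis ip psi h).
Proof.
move=> jn; apply: adjointE => f h; rewrite cov_lag // ip_synthesisl ip_synthesisr.
rewrite ctmxM; have -> : ((lag_mx j)^T)^H = lag_mx j.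
  apply/matrixP => i i'; rewrite !mxE.
  by case: eqP; rewrite ?rmorph0 // rmorphM fmorphV !rmorph_nat.
by rewrite mulmxA.
Qed.

(** At a position [(i, k)] only the lag [|k - i|] contributes, through the
    coefficient of index [k - i]. *)
Lemma toeplitz_lag l (a : int -> C) :
  toeplitz_mx n l a = a 0 *: lag_mx 0 +
    \sum_(1 <= j < l.+1) (a j%:Z *: lag_mx j + a (- j%:Z) *: (lag_mx j)^T).
Proof.
apply/matrixP => i k; rewrite mxE [RHS]mxE summxE /=.
have lagE j : (a j%:Z *: lag_mx j + a (- j%:Z) *: (lag_mx j)^T) i k =
    (if (k == i + j :> nat)%N then a j%:Z * (n%:R / (n - j)%:R) else 0) +
    (if (i == k + j :> nat)%N then a (- j%:Z) * (n%:R / (n - j)%:R) else 0).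
  by rewrite !mxE; do 2![case: ifP => _]; rewrite ?mulr0.
under eq_bigr do rewrite lagE; rewrite big_split /= -!big_mkcond /= !mxE addn0.
have [ik|ki|ik] := ltngtP (i : nat) k.
- have jE j : (k == i + j :> nat)%N = (j == k - i)%N by lia.
  have jE' j : (i == k + j :> nat)%N = false by lia.
  rewrite (eq_bigl _ _ jE) (eq_bigl _ _ jE') big_pred0_eq big_nat1_eq.
  have -> : (k%:Z - i%:Z)%R = (k - i)%N%:Z by lia.
  rewrite absz_nat subn_gt0 ik /= ltnS mulr0 add0r addr0.
  by case: ifP => // _; rewrite mulrCA mulrA.
- have jE j : (k == i + j :> nat)%N = false by lia.
  have jE' j : (i == k + j :> nat)%N = (j == i - k)%N by lia.
  rewrite (eq_bigl _ _ jE) (eq_bigl _ _ jE') big_pred0_eq big_nat1_eq.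
  have -> : (k%:Z - i%:Z)%R = - (i - k)%N%:Z by lia.
  rewrite abszN absz_nat subn_gt0 ki /= ltnS mulr0 !add0r.
  by case: ifP => // _; rewrite mulrCA mulrA.
have diag0 (F : nat -> C) : \sum_(1 <= j < l.+1 | (k == k + j :> nat)%N) F j = 0.
  by rewrite big_nat_cond big1 // => j /andP [/andP [j1 _] /eqP kj]; lia.
by rewrite ik subrr absz0 leq0n subn0 !diag0 !addr0 mulrCA mulrA.
Qed.

Lemma emp_W_toeplitz l (a : int -> C) h : (l < n)%N ->
  emp_W ip phi x a l h = synthesis psi (toeplitz_mx n l a *m analysis ip psi h).
Proof.
move=> ln; rewrite toeplitz_lag mulmxDl synthesisD mulmx_suml linear_sum.
rewrite /emp_W cov_lag // -scalemxAl synthesisZ; congr (_ + _).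
apply: eq_big_nat => j /andP [j1 jl].
have jn : (j < n)%N by apply: leq_ltn_trans ln.
by rewrite cov_lag // cov_lag_adjoint // mulmxDl /= synthesisD -!scalemxAl !synthesisZ.
Qed.

Lemma reg_cov_shift (g : R) h :
  reg_cov ip phi x g h = g%:C *: h + synthesis psi (analysis ip psi h).
Proof.
rewrite /reg_cov cov_lag // addrC; congr (_ + synthesis _ _).
rewrite -[RHS]mul1mx; congr (_ *m _); apply/matrixP => i i'.
rewrite !mxE addn0 subn0 divff ?pnatr_eq0 -?lt0n // -val_eqE eq_sym.
by case: eqP.
Qed.

End CenteredFeatures.

(** * The estimator *)

Lemma svd_is_svd (R : realType) (H : lmodType R[i]) (ip : {dot H for @Num.conj R[i]})
    (B : H -> H) m (s : 'I_m -> R) p q :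
  svd ip B s p q -> is_svd ip B (fun i => (s i)%:C) p q.
Proof.
case=> s0 sS pp qq BE; split=> // [i|i j ij]; first by rewrite ltcR.
by rewrite lecR sS.
Qed.

Lemma sqrtC_real (R : rcfType) (t : R) : 0 <= t ->
  sqrtC (t%:C : R[i]) = (Num.sqrt t)%:C.
Proof.
move=> t0; rewrite -[in LHS](sqr_sqrtr t0) rmorphXn /= sqrCK //.
by rewrite lecR sqrtr_ge0.
Qed.

Lemma is_svd_svd (R : realType) (H : lmodType R[i]) (ip : {dot H for @Num.conj R[i]})
    (B : H -> H) m (s : 'I_m -> R) p q :
  is_svd ip B (fun i => (s i)%:C) p q -> svd ip B s p q.
Proof.
case=> s0 sS pp qq BE; split=> // [i|i j ij]; first by rewrite -ltcR.
by rewrite -lecR sS.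
Qed.

Lemma conjC_fixed_Im (R : rcfType) (z : R[i]) : z^_* = z -> complex.Im z = 0.
Proof.
case: z => a b [] /eqP; rewrite eq_sym -subr_eq0 opprK -mulr2n mulrn_eq0 /=.
by move/eqP.
Qed.

Lemma conjC_opp_Re (R : rcfType) (z : R[i]) : z^_* = - z -> complex.Re z = 0.
Proof.
case: z => a b [] /eqP; rewrite -subr_eq0 opprK -mulr2n mulrn_eq0 /= => /eqP //.
Qed.

Theorem theorem4p2
  (R : realType)
  (* the process, its state space and its law *)
  (D : nat) (dO dT : measure_display)
  (Omega : measurableType dO) (T : measurableType dT)
  (emb : T -> D.-tuple (measurableTypeR R)) (Temb : subset_of_Rn emb)
  (P : probability Omega R) (X : R -> Omega -> T)
  (pi : probability T R) (ker : R -> R.-pker T ~> T)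
  (HX : stationary_markov P X pi ker)
  (* the symbol and F(L) = T(A_Dt) *)
  (Dt : R) (Dt_gt0 : 0 < Dt)
  (As : (T -> R[i]) -> T -> R[i])
  (HAs : l2_adjoint pi (transfer ker Dt) As)
  (a : int -> R[i]) (HF : bounded_on_spectrum pi ker Dt a)
  (* the RKHS *)
  (H : lmodType R[i]) (ip : {dot H for @Num.conj R[i]})
  (ev : H -> T -> R[i]) (phi : T -> H) (k : T -> T -> R)
  (HH : is_rkhs pi ip ev phi k)
  (* the trajectory *)
  (n l r : nat) (hl : (l + 2 < n)%N) (hr : (1 <= r <= n)%N)
  (t0 : R) (t0_ge0 : 0 <= t0) (w : Omega) (x : 'I_n -> T)
  (Hx : forall i : 'I_n, x i = X (t0 + i%:R * Dt) w)
  (gamma : R) (gamma_gt0 : 0 < gamma)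
  (* the generalized eigenvalue problem *)
  (lam : seq R) (sigma : 'I_r -> R) (U : 'M[R[i]]_(n, r)) :
  let J := Complexify (centering R n) in
  let K := Complexify (cgram x k) in
  let Kg := Complexify (reg_cgram x k gamma) in
  let Tn := toeplitz_mx n l a in
  let V := K *m U in
  pencil_eigenvalues (Tn *m K *m Tn^H *m K) Kg lam ->
  (forall i : 'I_r, sigma i ^+ 2 = lam`_i) ->
  (forall i, Tn *m K *m Tn^H *m K *m col i U =
             (sigma i ^+ 2)%:C *: (Kg *m col i U)) ->
  (forall i, (col i U)^H *m K *m Kg *m col i U = 1%:M) ->
  (forall i j, i != j -> sigma i ^+ 2 = sigma j ^+ 2 ->
     (col i U)^H *m K *m Kg *m col j U = 0) ->
  (* the eigenvalue decomposition of V^H Tn V *)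
  diagonalizable (V^H *m Tn *m V) ->
  forall (nu : 'I_r -> R[i]) (wl wr : 'I_r -> 'cV[R[i]]_r),
  (forall i, V^H *m Tn *m V *m wr i = nu i *: wr i) ->
  (forall i, (wl i)^H *m (V^H *m Tn *m V) = nu i *: (wl i)^H) ->
  (forall i j, (wl i)^H *m wr j = ((i == j)%:R)%:M) ->
  let B := whitened_W ip phi x a l gamma in
  let g i := sampling_adj phi x (J *m Tn^H *m V *m wl i) in
  let h i := sampling_adj phi x (J *m U *m wr i) in
  [/\ (* the u_i provide leading left singular vectors of B *)
      exists m (s : 'I_m -> R) (p q : 'I_m -> H),
        svd ip B s p q /\ corresponding_vectors ip phi x gamma U p,
      forall m (s : 'I_m -> R) (p q : 'I_m -> H),
        svd ip B s p q ->
        (svd_tie r s -> corresponding_vectors ip phi x gamma U p) ->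
        spectral_decomposition ip
          (rrr_estimator ip phi x gamma r s p q) nu g h,
      forall F, toeplitz_operator pi (transfer ker Dt) As a F ->
        l2_selfadjoint pi F ->
        symbols_separated pi (transfer ker Dt) As l a (adjoint_symbol a) ->
        forall i, complex.Im (nu i) = 0
    & forall F, toeplitz_operator pi (transfer ker Dt) As a F ->
        l2_skewadjoint pi F ->
        symbols_separated pi (transfer ker Dt) As l a
          (fun j => - adjoint_symbol a j) ->
        forall i, complex.Re (nu i) = 0 ].
Proof.
move=> J K Kg Tn V [lamS pencil] sigE MU UU1 UUtie _ nu wl wr Nwr wlN bio B g h.
have n0 : (0 < n)%N by apply: leq_ltn_trans hl.
have ln : (l < n)%N by apply: leq_ltn_trans hl; rewrite leq_addr.
have rn : (r <= n)%N by case/andP: hr.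
pose psi := centered_feature phi x.
have KE : K = frame_gram ip psi.
  by apply: centered_gram => // y z; exact: rkhs_kernel HH y z.
have KgE : Kg = K + (gamma%:C)%:M by rewrite /Kg /reg_cgram map_mxD map_scalar_mx.
pose Q := inv_sqrt ip (reg_cov ip phi x gamma).
have [Ql Qsa QQA AQQ] : [/\ linear Q, forall f g, ip (Q f) g = ip f (Q g),
    forall h, Q (Q (reg_cov ip phi x gamma h)) = h &
    forall h, reg_cov ip phi x gamma (Q (Q h)) = h].
  apply: (@inv_sqrt_shifted_frame R H ip n psi gamma) => // f.
  exact: reg_cov_shift.
have {}QQA f : Q (Q (gamma%:C *: f + synthesis psi (analysis ip psi f))) = f.
  by rewrite -(reg_cov_shift ip phi x n0) QQA.
have {}AQQ f : gamma%:C *: Q (Q f) + synthesis psi (analysis ip psi (Q (Q f))) = f.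
  by rewrite -(reg_cov_shift ip phi x n0) AQQ.
have BE : B = whitened_op ip psi Tn Q.
  by apply/funext => f; rewrite /B /whitened_W (emp_W_toeplitz ip phi x n0).
have Kh : K^H = K by rewrite KE frame_gram_herm.
have Kgh : Kg^H = Kg.
  by rewrite KgE ctmx_shift //; exact: conjc_real.
have KKg : K *m Kg = Kg *m K.
  by rewrite KgE mulmxDr mulmxDl mul_scalar_mx mul_mx_scalar.
pose lc : seq R[i] := [seq t%:C | t <- lam].
have lcE i : lc`_i = (lam`_i)%:C.
  have [il|il] := ltnP i (size lam); first by rewrite (nth_map 0).
  by rewrite !nth_default ?size_map.
have lcR i : (lc`_i)^_* = lc`_i by rewrite lcE; exact: conjc_real.
have lcS : sorted (fun y z => z <= y) lc.
  by rewrite sorted_map; apply: sub_sorted lamS => y z /=; rewrite lecR.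
have MU' : Tn *m K *m Tn^H *m K *m U = Kg *m U *m diag_mx (\row_i lc`_i).
  by apply: eq_col => j; rewrite col_mul_diag mxE !col_mulmx MU sigE lcE.
(* Columns with equal eigenvalues are orthogonal by assumption, the others
   because multiplication by [K] makes both matrices of the pencil Hermitian. *)
have UU : U^H *m K *m Kg *m U = 1%:M.
  apply/matrixP => i j; rewrite -(mulmxA _ K Kg) -ctm_col_entry (mulmxA _ K Kg) [RHS]mxE.
  have [<-|ij] := eqVneq i j; first by rewrite UU1 mxE eqxx.
  have [sij|sij] := eqVneq (sigma i ^+ 2) (sigma j ^+ 2).
    by rewrite UUtie // mxE.
  rewrite -(mulmxA _ K Kg).
  rewrite (@pencil_orthogonal _ _ (K *m (Tn *m K *m Tn^H *m K)) _
    (sigma i ^+ 2)%:C (sigma j ^+ 2)%:C) //.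
  - by rewrite mxE.
  - by rewrite !ctmxM ctmxK Kh !mulmxA.
  - by rewrite ctmxM Kh Kgh KKg.
  - exact: conjc_real.
  - by apply: contra sij => /eqP [->].
  - by rewrite -(mulmxA K) MU -scalemxAr mulmxA.
  - by rewrite -(mulmxA K) MU -scalemxAr mulmxA.
have [m0 [p0 [q0 [svd0 lam0 pU0]]]] : exists m (p q : 'I_m -> H),
    [/\ is_svd ip B (fun i => sqrtC lc`_i) p q,
        forall i : 'I_m, 0 <= lc`_i &
        forall (i : 'I_m) (j : 'I_r), i = j :> nat ->
          Q (p i) = synthesis psi (col j U)].
  have g0 : 0 < gamma%:C by rewrite ltcR.
  have pencil' : \det ('X *: map_mx polyC Kg - map_mx polyC (Tn *m K *m Tn^H *m K)) =
      (\det Kg)%:P * \prod_(t <- lc) ('X - t%:P) by rewrite pencil /lc big_map.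
  move: pencil' MU' UU; rewrite KgE KE BE => pencil' MU' UU.
  exact: (whitened_op_leading_svd Ql Qsa QQA g0 lcR lcS pencil' rn MU' UU).
have corrE m (p : 'I_m -> H) : corresponding_vectors ip phi x gamma U p <->
    forall (i : 'I_m) (j : 'I_r), i = j :> nat -> Q (p i) = synthesis psi (col j U).
  by split=> pU i j ij; have := pU i j ij; rewrite sampling_adj_centering.
have svdR : svd ip B (fun i : 'I_m0 => Num.sqrt lam`_i) p0 q0.
  apply: is_svd_svd; congr (is_svd ip B): svd0; apply/funext => i.
  by rewrite lcE sqrtC_real // -lecR -lcE.
have ev_sign (e : R[i]) i : Tn^H = e *: Tn -> (nu i)^_* = e * nu i.
  move=> Te; apply: (sign_eigenvalue _ (Nwr i)).
    exact: ctmx_congruence.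
  apply/eqP => wr0; have /matrixP/(_ 0 0) := bio i i.
  by rewrite wr0 mulmx0 eqxx !mxE => /eqP; rewrite eq_sym oner_eq0.
split.
- exists m0, (fun i : 'I_m0 => Num.sqrt lam`_i), p0, q0; split=> //.
  exact/corrE.
- move=> m s p q svdB tieU.
  have truncE m' (s' : 'I_m' -> R) p' q' : svd ip B s' p' q' ->
      corresponding_vectors ip phi x gamma U p' -> forall f,
      Q (svd_trunc ip r s' p' q' f) =
      synthesis psi (U *m (U^H *m K *m Tn *m analysis ip psi f)).
    move=> /svd_is_svd; rewrite BE KE => svd' /corrE pU f.
    apply: (whitened_op_truncation Ql Qsa QQA AQQ _ svd' pU f).
    by rewrite -KE -KgE.
  (* With a tie at [r] the given vectors correspond to [U] by assumption; without
     one, the truncation is that of the decomposition built from [U]. *)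
  have GE : rrr_estimator ip phi x gamma r s p q =
      fun f => synthesis psi (U *m (U^H *m K *m Tn *m analysis ip psi f)).
    apply/funext => f; have [/tieU pU|notie] := pselect (svd_tie r s).
      exact: truncE svdB pU f.
    rewrite -(truncE _ _ _ _ svdR) //; last exact/corrE.
    congr (Q _); apply: (svd_truncation_unique (svd_is_svd svdB) (svd_is_svd svdR)).
    by move=> [i [j [ir jr /(congr1 (@complex.Re R)) /= sij]]]; apply: notie; exists i, j.
  have hE i : h i = synthesis psi (U *m wr i).
    by rewrite /h -mulmxA sampling_adj_centering.
  have gE i : g i = synthesis psi (Tn^H *m K *m U *m wl i).
    by rewrite /g /V -!mulmxA sampling_adj_centering.
  rewrite GE KE; split=> [i|i|z z0].
  + rewrite hE; apply: compression_right; rewrite -KE; exact: Nwr.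
  + rewrite gE (adjointE (compression_adjoint _ _ _ _)) KE.
    by apply: compression_left; rewrite -KE; exact: wlN.
  + move: Nwr wlN; rewrite /V KE => Nwr' wlN'.
    exact: (compression_alg_multiplicity Nwr' wlN' bio z0).
- move=> F Fa Fsa sep i; apply: conjC_fixed_Im; rewrite -[RHS]mul1r.
  apply: ev_sign; apply: toeplitz_mx_adjoint => j jl; rewrite mul1r.
  by rewrite -(separated_selfadjoint_symbol HAs Fa Fsa sep).
- move=> F Fa Fsk sep i; apply: conjC_opp_Re; rewrite -mulN1r.
  apply: ev_sign; apply: toeplitz_mx_adjoint => j jl; rewrite mulN1r.
  by rewrite [in RHS](separated_skewadjoint_symbol HAs Fa Fsk sep) // opprK.
Qed.
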